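(* Consider a time dependent point game (TDPG) with final point $[\beta,\alpha]$. Suppose that for every (single-line) transition of the TDPG, with initial points of coordinates $x_{g_1},x_{g_2},\dots$ and weights $p_{g_1},p_{g_2},\dots$ and final points of coordinates $x_{h_1},x_{h_2},\dots$ and weights $p_{h_1},p_{h_2},\dots$ along the line of the transition (the coordinates being the $x$-coordinates if the transition is horizontal and the $y$-coordinates if it is vertical), there is a unitary $U$ acting on the space $\mathrm{span}\{|g_1\rangle,|g_2\rangle,\dots,|h_1\rangle,|h_2\rangle,\dots\}$, where the vectors $|g_i\rangle,|h_i\rangle$ are orthonormal, such that $$U|v\rangle=|w\rangle,\qquad \sum_i x_{h_i}|h_i\rangle\langle h_i|-\sum_i x_{g_i}E_hU|g_i\rangle\langle g_i|U^\dagger E_h\ \ge\ 0,$$ where $E_h=\sum_i|h_i\rangle\langle h_i|$, $|v\rangle=\sum_i\sqrt{p_{g_i}}|g_i\rangle/\sqrt{\sum_i p_{g_i}}$ and $|w\rangle=\sum_i\sqrt{p_{h_i}}|h_i\rangle/\sqrt{\sum_i p_{h_i}}$. Then the weak coin flipping protocol obtained from the TDPG and these unitaries by the TDPG-to-Explicit-protocol Framework (TEF, described in the context) has the corresponding bias, i.e. its cheating probabilities satisfy $P_A^*\le\alpha$ and $P_B^*\le\beta$.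
   Context: Point games. For a point $[a,b]$ of the plane, $[a,b]$ also denotes the function equal to $1$ at $(a,b)$ and $0$ elsewhere. A TDPG is a finite sequence of frames, i.e. finitely supported functions $[0,\infty)^2\to[0,\infty)$, starting with $\frac12[0,1]+\frac12[1,0]$ and ending with $1\cdot[\beta,\alpha]$. Consecutive frames are related by a horizontal or a vertical transition. A horizontal transition changes only points on a horizontal line $\{y=\text{const}\}$: the initial frame is $\sum_i p_{k_i}[x_{k_i},y_{k_i}]+\sum_i p_{g_i}[x_{g_i},y]$ and the final frame is $\sum_i p_{h_i}[x_{h_i},y]+\sum_i p_{k_i}[x_{k_i},y_{k_i}]$, with $p_{g_i},p_{h_i},p_{k_i}>0$, $\sum_i p_{g_i}=\sum_i p_{h_i}$, and $\sum_i\frac{\lambda x_{g_i}}{\lambda+x_{g_i}}p_{g_i}\le\sum_i\frac{\lambda x_{h_i}}{\lambda+x_{h_i}}p_{h_i}$ for all $\lambda>0$. Vertical transitions are the same with the roles of $x$ and $y$ exchanged. (If several parallel lines change at once, the transition is performed line after line.) Weak coin flipping (WCF) protocols. Alice and Bob have private spaces $\mathcal A,\mathcal B$ and exchange a message register $\mathcal M$; the initial state is a product state. In each round the player holding $\mathcal M$ applies to his or her private register together with $\mathcal M$ a unitary and a two-outcome projective measurement $\{E,\mathbb I-E\}$ (in a prescribed order); on the outcome $\mathbb I-E$ the player stops and declares himself or herself the winner, otherwise $\mathcal M$ is passed to the other player. At the end the players measure $\{\Pi_A^{(0)},\Pi_A^{(1)}\}$ on $\mathcal A$ and $\{\Pi_B^{(0)},\Pi_B^{(1)}\}$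 on $\mathcal B$; outcome $0$ means Alice wins, outcome $1$ means Bob wins. If both players are honest, no intermediate measurement ever gives $\mathbb I-E$, the final outcomes agree, and each player wins with probability $1/2$. $P_B^*$ is the maximum, over all strategies of a cheating Bob, of the probability that an honest Alice outputs $1$; $P_A^*$ is the maximum, over all strategies of a cheating Alice, of the probability that an honest Bob outputs $0$. The protocol has bias $\epsilon$ if $\max(P_A^*,P_B^* )\le\frac12+\epsilon$. TEF. Every frame is represented by a state in canonical form $\sum_i\sqrt{p_i}\,|ii\rangle_{AB}\otimes|m\rangle_M$, with one label $i$ per point of the frame ($p_i$ its weight), the label vectors being orthonormal and orthogonal to the idle message state $|m\rangle$. A horizontal transition, in which the unchanged points are labelled $k_i$, the initial points $g_i$ and the final points $h_i$, is implemented by the following steps. (1) Bob, holding $\mathcal M$, applies the unitary that swaps registers $B$ and $M$ when both are in $\mathrm{span}\{|g_1\rangle,|g_2\rangle,\dots,|m\rangle\}$ and is the identity otherwise, and sends $\mathcal M$ to Alice. (2) Alice applies $U^{(2)}_{AM}$, which acts as $U$ on $\mathrm{span}\{|g_ig_i\rangle_{AM},|h_ih_i\rangle_{AM}\}$ under the identification $|g_i\rangle\mapsto|g_ig_i\rangle_{AM}$, $|h_i\rangle\mapsto|h_ih_i\rangle_{AM}$ and as the identity on the orthogonal complement; then she measures $\{E^{(2)},\mathbb I-E^{(2)}\}$ with $E^{(2)}=(\sum_i|h_i\rangle\langle h_i|+\sum_i|k_i\rangle\langle k_i|)_A\otimes\mathbb I_M$, and sends $\mathcal M$ to Bob. (3)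 Bob applies the analogous conditional swap on $\mathrm{span}\{|h_1\rangle,|h_2\rangle,\dots,|m\rangle\}$ and measures $\{E^{(3)},\mathbb I-E^{(3)}\}$ with $E^{(3)}=(\sum_i|h_i\rangle\langle h_i|+\sum_i|k_i\rangle\langle k_i|)_B\otimes\mathbb I_M$. For vertical transitions the roles of Alice and Bob are exchanged. Concatenating these steps over all transitions of the TDPG gives a sequence of operations from the canonical state of the frame $\frac12[0,1]+\frac12[1,0]$ to the product state representing $[\beta,\alpha]$. The TEF protocol is this sequence run in reverse order with every operation replaced by its adjoint (so each $E\,U$ becomes $U^\dagger E$: first the measurement, then the inverse unitary). It starts from the product state representing $[\beta,\alpha]$ and ends with the canonical state of $\frac12[0,1]+\frac12[1,0]$, where $\Pi_A^{(1)}$ is the projector onto the label of the point $[1,0]$ on Alice's register, $\Pi_B^{(0)}$ is the projector onto the label of the point $[0,1]$ on Bob's register, $\Pi_A^{(0)}=\mathbb I-\Pi_A^{(1)}$ and $\Pi_B^{(1)}=\mathbb I-\Pi_B^{(0)}$. *)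

(* Defs.v *)
Set Warnings "-ambiguous-paths,-notation-overridden".
From mathcomp Require Import all_boot all_order all_algebra.
From mathcomp Require Import spectral complex.
From mathcomp Require Import boolp classical_sets reals constructive_ereal ereal.

Set Implicit Arguments.
Unset Strict Implicit.
Unset Printing Implicit Defensive.

Import Order.TTheory GRing.Theory Num.Theory.
Local Open Scope ring_scope.
Local Open Scope complex_scope.
Local Open Scope sesquilinear_scope.

(* [Ket R T] is the space C^T and [Op R T] its endomorphisms; the basis vector
   |t> sits at position [enum_rank t].  A tensor product of spaces is indexed
   by the product of the index types. *)
Notation Ket R T := ('cV[R[i]]_#|{: T}|).
Notation Op R T := ('M[R[i]]_#|{: T}|).

Definition ket (R : realType) (T : finType) (t : T) : Ket R T :=
  delta_mx (enum_rank t) 0.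

Definition ket_of (R : realType) (T : finType) (f : T -> R[i]) : Ket R T :=
  \col_i f (enum_val i).

Definition op_of (R : realType) (T : finType) (f : T -> T -> R[i]) : Op R T :=
  \matrix_(i, j) f (enum_val i) (enum_val j).

Definition kentry (R : realType) (T : finType) (v : Ket R T) (t : T) : R[i] :=
  v (enum_rank t) 0.

Definition entry (R : realType) (T : finType) (X : Op R T) (s t : T) : R[i] :=
  X (enum_rank s) (enum_rank t).

Definition proj (R : realType) (T : finType) (S : {set T}) : Op R T :=
  \sum_(t in S) ket R t *m (ket R t)^t*.

Definition normsq (R : realType) (T : finType) (v : Ket R T) : R :=
  complex.Re ((v^t* *m v) 0 0).

(* [0 <= z] in R[i] says that z is a nonnegative real, so this entails that X
   is Hermitian. *)
Definition psd (R : realType) (T : finType) (X : Op R T) : Prop :=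
  forall v : Ket R T, 0 <= (v^t* *m X *m v) 0 0.

Definition projective (R : realType) (T : finType) (E : Op R T) : Prop :=
  E^t* = E /\ E *m E = E.

Definition density (R : realType) (T : finType) (X : Op R T) : Prop :=
  psd X /\ \tr X = 1.

(* Kraus operators of a trace-preserving completely positive map. *)
Definition channel (R : realType) (T : finType) (Ks : seq (Op R T)) : Prop :=
  \sum_(K <- Ks) K^t* *m K = 1%:M.

(* The operator X (x) I, where [split] identifies the basis of the whole space
   with that of (space X acts on) (x) (rest). *)
Definition lift_op (R : realType) (T S E : finType) (split : T -> S * E)
    (X : Op R S) : Op R T :=
  op_of (fun s t => entry X (split s).1 (split t).1
                    * ((split s).2 == (split t).2)%:R).

(* The total space is A (x) B (x) M. *)
Definition splitAM (A B M : finType) (t : A * B * M) : (A * M) * B :=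
  ((t.1.1, t.2), t.1.2).
Definition splitBM (A B M : finType) (t : A * B * M) : (B * M) * A :=
  ((t.1.2, t.2), t.1.1).
Definition splitA (A B M : finType) (t : A * B * M) : A * (B * M) :=
  (t.1.1, (t.1.2, t.2)).
Definition splitB (A B M : finType) (t : A * B * M) : B * (A * M) :=
  (t.1.2, (t.1.1, t.2)).

(* What a player does to private register (x) M: a unitary and a measurement
   {E, I - E}, in the order given by [measures_first].  An operation without
   measurement has E = I. *)
Record action (R : realType) (T : finType) := Action {
  act_U : Op R T;
  act_E : Op R T;
  measures_first : bool }.

(* The (unnormalised) effect of the action when the outcome is E. *)
Definition passed (R : realType) (T : finType) (a : action R T) : Op R T :=
  if measures_first a then act_U a *m act_E a else act_E a *m act_U a.

(* Annihilates exactly the states for which the outcome I - E never occurs. *)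
Definition failed (R : realType) (T : finType) (a : action R T) : Op R T :=
  if measures_first a then 1%:M - act_E a else (1%:M - act_E a) *m act_U a.

Definition adj_action (R : realType) (T : finType) (a : action R T) :
    action R T :=
  Action ((act_U a)^t*) (act_E a) (~~ measures_first a).

Definition action_ok (R : realType) (T : finType) (a : action R T) : Prop :=
  act_U a \is unitarymx /\ projective (act_E a).

(* The constructor tells who acts, hence who holds M: between two consecutive
   rounds M is handed over exactly when the acting player changes, and
   initially M is with the player of the first round. *)
Inductive round (R : realType) (A B M : finType) :=
| ByAlice of action R (A * M)%type
| ByBob of action R (B * M)%type.

Definition adj_round (R : realType) (A B M : finType) (r : round R A B M) :
    round R A B M :=
  match r with
  | ByAlice a => ByAlice _ (adj_action a)
  | ByBob a => ByBob _ (adj_action a)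
  end.

Record protocol (R : realType) (A B M : finType) := Protocol {
  psiA : Ket R A;
  psiB : Ket R B;
  psiM : Ket R M;
  rounds : seq (round R A B M);
  (* final projectors; false is the outcome 0 (Alice wins), true the outcome 1
     (Bob wins) *)
  PiA : bool -> Op R A;
  PiB : bool -> Op R B }.

Definition round_ok (R : realType) (A B M : finType) (r : round R A B M) :
    Prop :=
  match r with ByAlice a => action_ok a | ByBob a => action_ok a end.

Definition well_formed (R : realType) (A B M : finType)
    (P : protocol R A B M) : Prop :=
  [/\ [/\ normsq (psiA P) = 1, normsq (psiB P) = 1 & normsq (psiM P) = 1],
      forall k r, onth (rounds P) k = Some r -> round_ok r,
      forall b, projective (PiA P b) /\ projective (PiB P b),
      PiA P false + PiA P true = 1%:M
    & PiB P false + PiB P true = 1%:M].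

Definition round_passed (R : realType) (A B M : finType)
    (r : round R A B M) : Op R (A * B * M)%type :=
  match r with
  | ByAlice a => lift_op (@splitAM A B M) (passed a)
  | ByBob a => lift_op (@splitBM A B M) (passed a)
  end.

Definition round_failed (R : realType) (A B M : finType)
    (r : round R A B M) : Op R (A * B * M)%type :=
  match r with
  | ByAlice a => lift_op (@splitAM A B M) (failed a)
  | ByBob a => lift_op (@splitBM A B M) (failed a)
  end.

Definition initial_state (R : realType) (A B M : finType)
    (P : protocol R A B M) : Ket R (A * B * M)%type :=
  ket_of (fun t => kentry (psiA P) t.1.1 * kentry (psiB P) t.1.2
                   * kentry (psiM P) t.2).

Fixpoint honest_run (R : realType) (A B M : finType)
    (rs : seq (round R A B M)) (psi : Ket R (A * B * M)%type) :
    Ket R (A * B * M)%type :=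
  if rs is r :: rs' then honest_run rs' (round_passed r *m psi) else psi.

Fixpoint never_fails (R : realType) (A B M : finType)
    (rs : seq (round R A B M)) (psi : Ket R (A * B * M)%type) : Prop :=
  if rs is r :: rs' then
    normsq (round_failed r *m psi) = 0
    /\ never_fails rs' (round_passed r *m psi)
  else True.

Definition honest_prob (R : realType) (A B M : finType)
    (P : protocol R A B M) (a b : bool) : R :=
  normsq (lift_op (@splitA A B M) (PiA P a)
          *m (lift_op (@splitB A B M) (PiB P b)
          *m honest_run (rounds P) (initial_state P))).

Definition is_wcf (R : realType) (A B M : finType) (P : protocol R A B M) :
    Prop :=
  [/\ well_formed P,
      never_fails (rounds P) (initial_state P),
      honest_prob P false true = 0 /\ honest_prob P true false = 0
    & honest_prob P false false = 2^-1 /\ honest_prob P true true = 2^-1].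

(* One honest player H faces a cheater.  The honest player's view lists the
   rounds: [Some X] is a round of H (X is its effect when the outcome is E; on
   the other outcome H declares himself or herself the winner, so that branch
   never contributes to the cheater's success), [None] is a round of the
   cheater. *)
Definition alice_view (R : realType) (A B M : finType)
    (P : protocol R A B M) : seq (option (Op R (A * M)%type)) :=
  [seq (match r with ByAlice a => Some (passed a) | ByBob _ => None end)
  | r <- rounds P].

Definition bob_view (R : realType) (A B M : finType)
    (P : protocol R A B M) : seq (option (Op R (B * M)%type)) :=
  [seq (match r with ByAlice _ => None | ByBob a => Some (passed a) end)
  | r <- rounds P].

(* State of H (x) C (x) M, C being the cheater's private space, after the
   rounds of [view]; in the k-th round, if it is his, the cheater applies the
   channel [strat k] to C (x) M. *)
Fixpoint cheat_run (R : realType) (H C M : finType)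
    (strat : nat -> seq (Op R (C * M)%type)) (k : nat)
    (view : seq (option (Op R (H * M)%type)))
    (rho : Op R (H * C * M)%type) : Op R (H * C * M)%type :=
  match view with
  | [::] => rho
  | Some X :: view' =>
      let Y := lift_op (@splitAM H C M) X in
      cheat_run strat k.+1 view' (Y *m rho *m Y^t*)
  | None :: view' =>
      cheat_run strat k.+1 view'
        (\sum_(K <- strat k)
           lift_op (@splitBM H C M) K *m rho *m (lift_op (@splitBM H C M) K)^t*)
  end.

Definition cheat_initial (R : realType) (H C M : finType) (psiH : Ket R H)
    (psi : Ket R M) (sigma : Op R C) : Op R (H * C * M)%type :=
  op_of (fun s t => entry (psiH *m psiH^t*) s.1.1 t.1.1
                    * entry sigma s.1.2 t.1.2
                    * entry (psi *m psi^t*) s.2 t.2).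

(* Supremum, over all private dimensions d, private initial states and
   channels, of the probability that H passes every measurement and finally
   obtains the outcome of the projector [win]. *)
Definition cheat_value (R : realType) (H M : finType) (psiH : Ket R H)
    (psi : Ket R M) (view : seq (option (Op R (H * M)%type))) (win : Op R H) :
    \bar R :=
  ereal_sup [set p : \bar R |
    exists (d : nat) (sigma : Op R 'I_d)
           (strat : nat -> seq (Op R ('I_d * M)%type)),
      [/\ density sigma, forall k, channel (strat k)
        & p = (complex.Re (\tr (lift_op (@splitA H 'I_d M) win
                  *m cheat_run strat 0 view
                       (cheat_initial psiH psi sigma))))%:E]]%classic.

(* P_B^*: honest Alice outputs 1. *)
Definition PB_star (R : realType) (A B M : finType) (P : protocol R A B M) :
    \bar R :=
  cheat_value (psiA P) (psiM P) (alice_view P) (PiA P true).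

(* P_A^*: honest Bob outputs 0. *)
Definition PA_star (R : realType) (A B M : finType) (P : protocol R A B M) :
    \bar R :=
  cheat_value (psiB P) (psiM P) (bob_view P) (PiB P false).

(* The finitely supported function sum_(i in pts) wt i [pos i] on the plane,
   presented with one label in L per term; [pos] and [wt] are irrelevant
   outside [pts].  Two labels may sit at the same position, e.g. when a final
   point of a transition lands on an unchanged point. *)
Record frame (R : realType) (L : finType) := Frame {
  pts : {set L};
  pos : L -> R * R;
  wt : L -> R }.

Definition frame_ok (R : realType) (L : finType) (F : frame R L) : Prop :=
  forall i, i \in pts F ->
    [/\ 0 <= (pos F i).1, 0 <= (pos F i).2 & 0 < wt F i].

Inductive direction := Horizontal | Vertical.

Definition along (R : realType) (d : direction) (z : R * R) : R :=
  match d with Horizontal => z.1 | Vertical => z.2 end.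

Definition across (R : realType) (d : direction) (z : R * R) : R :=
  match d with Horizontal => z.2 | Vertical => z.1 end.

(* The j-th transition goes from [frm j] to [frm j.+1]; [gs j] and [hs j] are
   the labels g_i and h_i of its initial and final points. *)
Record point_game (R : realType) (L : finType) := PointGame {
  len : nat;
  frm : nat -> frame R L;
  dir : nat -> direction;
  gs : nat -> {set L};
  hs : nat -> {set L};
  lab01 : L;
  lab10 : L;
  lab_end : L }.

Definition ks (R : realType) (L : finType) (G : point_game R L) (j : nat) :
    {set L} := pts (frm G j) :\: gs G j.

Definition xg (R : realType) (L : finType) (G : point_game R L) (j : nat)
    (i : L) : R := along (dir G j) (pos (frm G j) i).
Definition pg (R : realType) (L : finType) (G : point_game R L) (j : nat)
    (i : L) : R := wt (frm G j) i.
Definition xh (R : realType) (L : finType) (G : point_game R L) (j : nat)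
    (i : L) : R := along (dir G j) (pos (frm G j.+1) i).
Definition ph (R : realType) (L : finType) (G : point_game R L) (j : nat)
    (i : L) : R := wt (frm G j.+1) i.

Definition transition_ok (R : realType) (L : finType) (G : point_game R L)
    (j : nat) : Prop :=
  [/\ [/\ gs G j \subset pts (frm G j),
          [disjoint hs G j & pts (frm G j)]
        & pts (frm G j.+1) = hs G j :|: ks G j],
      forall i, i \in ks G j ->
        pos (frm G j.+1) i = pos (frm G j) i
        /\ wt (frm G j.+1) i = wt (frm G j) i,
      exists c : R,
        (forall i, i \in gs G j -> across (dir G j) (pos (frm G j) i) = c)
        /\ (forall i, i \in hs G j ->
              across (dir G j) (pos (frm G j.+1) i) = c),
      \sum_(i in gs G j) pg G j i = \sum_(i in hs G j) ph G j i
    & forall lam : R, 0 < lam ->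
        \sum_(i in gs G j) lam * xg G j i / (lam + xg G j i) * pg G j i
        <= \sum_(i in hs G j) lam * xh G j i / (lam + xh G j i) * ph G j i].

Definition is_tdpg (R : realType) (L : finType) (G : point_game R L)
    (beta alpha : R) : Prop :=
  [/\ forall j, (j <= len G)%N -> frame_ok (frm G j),
      forall j, (j < len G)%N -> transition_ok G j,
      [/\ lab01 G != lab10 G,
          pts (frm G 0) = [set lab01 G; lab10 G]%SET,
          pos (frm G 0) (lab01 G) = (0, 1)
          /\ wt (frm G 0) (lab01 G) = 2^-1
        & pos (frm G 0) (lab10 G) = (1, 0)
          /\ wt (frm G 0) (lab10 G) = 2^-1]
    & [/\ pts (frm G (len G)) = [set lab_end G]%SET,
          pos (frm G (len G)) (lab_end G) = (beta, alpha)
        & wt (frm G (len G)) (lab_end G) = 1]].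

(* U is a unitary of span{|i> : i in S}, extended by 0 to C^T. *)
Definition unitary_on (R : realType) (T : finType) (S : {set T})
    (U : Op R T) : Prop :=
  U^t* *m U = proj R S /\ U *m U^t* = proj R S.

(* sum_(i in S) sqrt (p i) |i> / sqrt (sum_(i in S) p i) *)
Definition weight_ket (R : realType) (T : finType) (S : {set T})
    (p : T -> R) : Ket R T :=
  \sum_(i in S) (Num.sqrt (p i) / Num.sqrt (\sum_(j in S) p j))%:C *: ket R i.

Definition good_unitary (R : realType) (L : finType) (G : point_game R L)
    (j : nat) (U : Op R L) : Prop :=
  let Eh := proj R (hs G j) in
  [/\ unitary_on (gs G j :|: hs G j) U,
      U *m weight_ket (gs G j) (pg G j) = weight_ket (hs G j) (ph G j)
    & psd (\sum_(i in hs G j) (xh G j i)%:C *: (ket R i *m (ket R i)^t*)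
           - \sum_(i in gs G j) (xg G j i)%:C *:
               (Eh *m U *m (ket R i *m (ket R i)^t*) *m U^t* *m Eh))].

(* Each of the registers A, B and M has basis |i> = [Some i] for i a label, and
   |m> = [None]; operators below act on (private register) (x) M. *)
Definition swap_op (R : realType) (L : finType) (S : {set L}) :
    Op R (option L * option L)%type :=
  let D := (None |: [set Some i | i in S])%SET in
  op_of (fun s t : option L * option L =>
    (s == if (t.1 \in D) && (t.2 \in D) then (t.2, t.1) else t)%:R).

(* The isometry |i> |-> |ii> from span{|i> : i in S}, extended by 0. *)
Definition dup (R : realType) (L : finType) (S : {set L}) :
    'M[R[i]]_(#|{: option L * option L}|, #|{: L}|) :=
  \sum_(i in S) ket R (Some i, Some i) *m (ket R i)^t*.

(* U on span{|ii> : i in S}, the identity on its orthogonal complement. *)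
Definition diag_op (R : realType) (L : finType) (S : {set L}) (U : Op R L) :
    Op R (option L * option L)%type :=
  dup R S *m U *m (dup R S)^t* + (1%:M - dup R S *m (dup R S)^t*).

(* proj S (x) I_M *)
Definition label_proj (R : realType) (L : finType) (S : {set L}) :
    Op R (option L * option L)%type :=
  lift_op (@id (option L * option L)%type) (proj R [set Some i | i in S]%SET).

Definition tef_rounds_fwd (R : realType) (L : finType) (G : point_game R L)
    (U : nat -> Op R L) (j : nat) :
    seq (round R (option L) (option L) (option L)) :=
  let E := label_proj R (hs G j :|: ks G j) in
  let step1 := Action (swap_op R (gs G j)) 1%:M false in
  let step2 := Action (diag_op (gs G j :|: hs G j) (U j)) E false in
  let step3 := Action (swap_op R (hs G j)) E false in
  match dir G j with
  | Horizontal => [:: ByBob _ step1; ByAlice _ step2; ByBob _ step3]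
  | Vertical => [:: ByAlice _ step1; ByBob _ step2; ByAlice _ step3]
  end.

Definition tef (R : realType) (L : finType) (G : point_game R L)
    (U : nat -> Op R L) : protocol R (option L) (option L) (option L) :=
  {| psiA := ket R (Some (lab_end G));
     psiB := ket R (Some (lab_end G));
     psiM := ket R None;
     rounds := [seq adj_round r | r <-
       rev (flatten [seq tef_rounds_fwd G U j | j <- iota 0 (len G)])];
     PiA := fun b => let Pi1 := proj R [set Some (lab10 G)]%SET in
                     if b then Pi1 else 1%:M - Pi1;
     PiB := fun b => let Pi0 := proj R [set Some (lab01 G)]%SET in
                     if b then 1%:M - Pi0 else Pi0 |}.

(* Main.v *)
Require Import Defs.
From mathcomp Require Import all_boot all_order all_algebra.
From mathcomp Require Import spectral complex.
From mathcomp Require Import reals constructive_ereal ereal.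

(* Against an honest player, the coordinates of the points of a frame along the
   direction in which that player performs the rotation U, put on the diagonal,
   form the dual operator of Kitaev's semidefinite program at that frame.  A
   transition in that direction preserves dual feasibility because of the
   operator inequality required of U.  A transition in the other direction is
   undone by two conditional swaps between which the cheater may act; all its
   moved points have the same coordinate c, and giving the weight c to the idle
   state as well restores feasibility in between.  The cheating probability is
   thus at most the coordinate of the final point. *)

Set Implicit Arguments.
Unset Strict Implicit.
Unset Printing Implicit Defensive.

Import Order.TTheory GRing.Theory Num.Theory.
Local Open Scope ring_scope.
Local Open Scope complex_scope.
Local Open Scope sesquilinear_scope.

(** * Conjugate transposes and quadratic forms *)

Section Adjoint.

Variable C : numClosedFieldType.

Lemma adjmxM m n p (X : 'M[C]_(m, n)) (Y : 'M[C]_(n, p)) :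
  (X *m Y)^t* = Y^t* *m X^t*.
Proof. by rewrite trmx_mul map_mxM. Qed.

Lemma adjmxD m n (X Y : 'M[C]_(m, n)) : (X + Y)^t* = X^t* + Y^t*.
Proof. by rewrite linearD map_mxD. Qed.

Lemma adjmxB m n (X Y : 'M[C]_(m, n)) : (X - Y)^t* = X^t* - Y^t*.
Proof. by rewrite linearB map_mxB. Qed.

Lemma adjmxZ m n a (X : 'M[C]_(m, n)) : (a *: X)^t* = Num.conj a *: X^t*.
Proof. by rewrite linearZ map_mxZ. Qed.

Lemma adjmx1 n : (1%:M : 'M[C]_n)^t* = 1%:M.
Proof. by rewrite trmx1 map_mx1. Qed.

Lemma adjmx_sum m n (I : Type) (r : seq I) (P : pred I) (F : I -> 'M[C]_(m, n)) :
  (\sum_(i <- r | P i) F i)^t* = \sum_(i <- r | P i) (F i)^t*.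
Proof. by rewrite linear_sum map_mx_sum. Qed.

(** The sesquilinear expansion behind both the polarization in [psd_adj] and the norm of a
    superposition of two basis vectors. *)
Lemma quad_lin2 n (X : 'M[C]_n) (u v : 'cV[C]_n) (a b : C) :
  ((a *: u + b *: v)^t* *m X *m (a *: u + b *: v)) 0 0
  = a * (Num.conj a * (u^t* *m X *m u) 0 0) + a * (Num.conj b * (v^t* *m X *m u) 0 0)
    + (b * (Num.conj a * (u^t* *m X *m v) 0 0)
       + b * (Num.conj b * (v^t* *m X *m v) 0 0)).
Proof.
rewrite adjmxD !adjmxZ mulmxDr !mulmxDl -!scalemxAr -!scalemxAl.
by move: (_ *m u) (_ *m u) (_ *m v) (_ *m v) => p q r t; rewrite !mxE.
Qed.

End Adjoint.

(** * Operators in coordinates and real diagonal operators *)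

Section Coordinates.

Variables (R : realType) (T : finType).
Implicit Types (X Y : Op R T) (s t u : T) (f g : T -> R).

Lemma entry_op_of h s t : entry (op_of h : Op R T) s t = h s t.
Proof. by rewrite /entry mxE !enum_rankK. Qed.

Lemma entryP X Y : (forall s t, entry X s t = entry Y s t) -> X = Y.
Proof.
move=> eqXY; apply/matrixP => i j.
by have := eqXY (enum_val i) (enum_val j); rewrite /entry !enum_valK.
Qed.

Lemma entryM X Y s t : entry (X *m Y) s t = \sum_u entry X s u * entry Y u t.
Proof.
by rewrite /entry mxE (reindex (@enum_rank T)) //;
  apply: (onW_bij _ (@enum_rank_bij T)).
Qed.

Lemma entryD X Y s t : entry (X + Y) s t = entry X s t + entry Y s t.
Proof. by rewrite /entry mxE. Qed.

Lemma entryB X Y s t : entry (X - Y) s t = entry X s t - entry Y s t.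
Proof. by rewrite /entry !mxE. Qed.

Lemma entry_adj X s t : entry (X^t*) s t = Num.conj (entry X t s).
Proof. by rewrite /entry !mxE. Qed.

Lemma entry1 s t : entry (1%:M : Op R T) s t = (s == t)%:R.
Proof. by rewrite /entry mxE (inj_eq enum_rank_inj). Qed.

Lemma mxtrace_entry X : \tr X = \sum_t entry X t t.
Proof.
by rewrite /mxtrace (reindex (@enum_rank T)) //;
  apply: (onW_bij _ (@enum_rank_bij T)).
Qed.

Lemma adj_ket_ket s t : (ket R s)^t* *m ket R t = (s == t)%:R%:M.
Proof.
rewrite /ket trmx_delta map_delta_mx mul_delta_mx_cond (inj_eq enum_rank_inj).
by apply/matrixP => i j; rewrite !ord1 !mxE !eqxx; case: eqP; rewrite ?mxE.
Qed.

Lemma entry_quad X s t : ((ket R s)^t* *m X *m ket R t) 0 0 = entry X s t.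
Proof.
by rewrite /ket trmx_delta map_delta_mx -rowE -colE !mxE.
Qed.

(** Label projectors, winning projectors and dual operators all have this real diagonal form, so
    identities and inequalities between them become pointwise. *)
Definition obs f : Op R T := op_of (fun s t => (f s)%:C * (s == t)%:R).

Lemma entry_obs f s t : entry (obs f) s t = (f s)%:C * (s == t)%:R.
Proof. exact: entry_op_of. Qed.

Lemma adj_obs f : (obs f)^t* = obs f.
Proof.
apply: entryP => s t; rewrite entry_adj !entry_obs eq_sym.
case: eqVneq => [->|_]; last by rewrite !mulr0 rmorph0.
by rewrite !mulr1; apply: conjc_real.
Qed.

Lemma entry_obsM f X s t : entry (obs f *m X) s t = (f s)%:C * entry X s t.
Proof.
rewrite entryM (bigD1 s) //= entry_obs eqxx mulr1 big1 ?addr0 // => u /negPf ne.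
by rewrite entry_obs eq_sym ne mulr0 mul0r.
Qed.

Lemma entry_Mobs f X s t : entry (X *m obs f) s t = entry X s t * (f t)%:C.
Proof.
rewrite entryM (bigD1 t) //= entry_obs eqxx mulr1 big1 ?addr0 // => u /negPf ne.
by rewrite entry_obs ne mulr0 mulr0.
Qed.

Lemma obsM f g : obs f *m obs g = obs (fun t => f t * g t).
Proof.
by apply: entryP => s t; rewrite entry_obsM !entry_obs mulrA -rmorphM.
Qed.

Lemma obsB f g : obs f - obs g = obs (fun t => f t - g t).
Proof.
by apply: entryP => s t; rewrite entryB !entry_obs -mulrBl -rmorphB.
Qed.

Lemma eq_obs f g : f =1 g -> obs f = obs g.
Proof. by move=> eqfg; apply: entryP => s t; rewrite !entry_obs eqfg. Qed.

Lemma obs_cst1 : obs (fun=> 1) = 1%:M.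
Proof. by apply: entryP => s t; rewrite entry_obs entry1 mul1r. Qed.

Lemma entry_ketbra s t u :
  entry (ket R u *m (ket R u)^t*) s t = ((s == u) && (t == u))%:R.
Proof.
rewrite /ket trmx_delta map_delta_mx mul_delta_mx /entry mxE.
by rewrite !(inj_eq enum_rank_inj).
Qed.

Lemma obs_ketbra (S : {set T}) f :
  \sum_(i in S) (f i)%:C *: (ket R i *m (ket R i)^t*)
  = obs (fun t => f t *+ (t \in S)).
Proof.
apply: entryP => s t; rewrite entry_obs {1}/entry summxE.
rewrite (eq_bigr (fun u => (f u)%:C * ((s == u) && (t == u))%:R)); last first.
  by move=> u _; rewrite mxE -entry_ketbra.
have [sS|sS] := boolP (s \in S); last first.
  rewrite mulr0n mul0r big1 // => u uS.
  by case: eqVneq sS uS => [->/negPf->|]; rewrite ?mulr0.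
rewrite (bigD1 s) //= eqxx eq_sym big1 ?addr0 // => u /andP[_ /negPf].
by rewrite eq_sym => ->; rewrite mulr0.
Qed.

Lemma proj_obs (S : {set T}) : proj R S = obs (fun t => (t \in S)%:R).
Proof.
rewrite /proj (eq_bigr (fun i => (1 : R)%:C *: (ket R i *m (ket R i)^t*))).
  by rewrite (obs_ketbra _ (fun=> 1)).
by move=> i _; rewrite scale1r.
Qed.

Lemma ketP (v w : Ket R T) : (forall t, kentry v t = kentry w t) -> v = w.
Proof.
move=> eqvw; apply/matrixP => i j; rewrite ord1.
by have := eqvw (enum_val i); rewrite /kentry !enum_valK.
Qed.

Lemma kentry_ket s t : kentry (ket R s) t = (t == s)%:R.
Proof. by rewrite /kentry mxE (inj_eq enum_rank_inj) eqxx andbT. Qed.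

Lemma kentryM X (v : Ket R T) t : kentry (X *m v) t = \sum_u entry X t u * kentry v u.
Proof.
by rewrite /kentry mxE (reindex (@enum_rank T)) //;
  apply: (onW_bij _ (@enum_rank_bij T)).
Qed.

Lemma kentryMket X s t : kentry (X *m ket R s) t = entry X t s.
Proof.
rewrite kentryM (bigD1 s) //= kentry_ket eqxx mulr1 big1 ?addr0 // => u /negPf ne.
by rewrite kentry_ket ne mulr0.
Qed.

Lemma obs_ket f t : obs f *m ket R t = (f t)%:C *: ket R t.
Proof.
apply: ketP => s; rewrite kentryMket entry_obs /kentry mxE -/(kentry _ _) kentry_ket.
by case: eqVneq => [->|]; rewrite ?mulr0.
Qed.

End Coordinates.

(** * Positive semidefinite operators *)

Section Positivity.

Variables (R : realType) (T : finType).
Implicit Types (X Y : Op R T).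

(** The quadratic form of [X] is real, so that of [X - X^t*] vanishes; over the complex numbers
    polarization then makes the operator itself vanish. *)
Lemma psd_adj X : psd X -> X^t* = X.
Proof.
move=> psdX.
have real (v : Ket R T) : ((v^t* *m X *m v) 0 0) = (v^t* *m X^t* *m v) 0 0.
  have /CrealP : ((v^t* *m X *m v) 0 0) \is Num.real
    by exact: ger0_real (psdX v).
  move=> {1}<-.
  have -> : v^t* *m X^t* *m v = (v^t* *m X *m v)^t*.
    by rewrite !adjmxM trmxCK mulmxA.
  by rewrite !mxE.
pose Y := X - X^t*.
have Y0 (v : Ket R T) : (v^t* *m Y *m v) 0 0 = 0.
  by rewrite mulmxBr mulmxBl mxE [X in _ + X]mxE -real subrr.
suff: Y = 0 by move/subr0_eq.
apply: entryP => s t; rewrite [RHS]mxE.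
have Ydiag u : entry Y u u = 0 by rewrite -entry_quad Y0.
have Yc c : c * entry Y s t + Num.conj c * entry Y t s = 0.
  have := Y0 (1 *: ket R s + c *: ket R t).
  by rewrite quad_lin2 !entry_quad !Ydiag !mulr0 rmorph1 !mul1r add0r addr0 addrC.
(* The value c = 1 makes the two off-diagonal entries opposite, the value c = i makes them equal. *)
have := Yc 1; rewrite rmorph1 !mul1r => /eqP; rewrite addr_eq0 => /eqP eY.
have := Yc (@Num.imaginary R[i]); rewrite conjCi mulNr -mulrN -mulrDr => /eqP.
rewrite mulf_eq0 (negPf (neq0Ci _)) /= -eY -mulr2n mulrn_eq0 /=.
by move/eqP.
Qed.

Lemma psd_conj (S : finType) (W : 'M[R[i]]_(#|S|, #|T|)) X :
  psd X -> psd (W *m X *m W^t* : Op R S).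
Proof.
by move=> psdX v; have := psdX (W^t* *m v); rewrite adjmxM trmxCK !mulmxA.
Qed.

Lemma psdD X Y : psd X -> psd Y -> psd (X + Y).
Proof.
by move=> pX pY v; rewrite mulmxDr mulmxDl mxE addr_ge0.
Qed.

Lemma psd_sum (I : Type) (r : seq I) (F : I -> Op R T) :
  (forall i, psd (F i)) -> psd (\sum_(i <- r) F i).
Proof.
move=> pF; elim: r => [|i r IH]; last by rewrite big_cons; exact: psdD (pF i) IH.
by rewrite big_nil => v; rewrite mulmx0 mul0mx mxE.
Qed.

(** A Hermitian operator is normal, so the spectral theorem applies; the eigenvalues are nonnegative
    and their square roots give the factor. *)
Lemma psd_factor X : psd X -> exists B : Op R T, X = B^t* *m B.
Proof.
move=> psdX; have /orthomx_spectralP Xspec : X \is normalmx.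
  by apply/normalmxP; rewrite psd_adj.
set P := spectralmx X in Xspec; set d := spectral_diag X in Xspec.
have Pun : P \is unitarymx by apply: spectral_unitarymx.
rewrite invmx_unitary // in Xspec.
(* An eigenvalue is the quadratic form evaluated at its unit eigenvector [P^t* *m e]. *)
have d_ge0 i : 0 <= d 0 i.
  pose e : Ket R T := delta_mx i 0.
  have -> : d 0 i = ((P^t* *m e)^t* *m X *m (P^t* *m e)) 0 0.
    rewrite {1}Xspec adjmxM trmxCK !mulmxA; move/unitarymxP: Pun => PP.
    rewrite -[_ *m P *m P^t*]mulmxA PP mulmx1 -!mulmxA [P *m _]mulmxA PP mul1mx.
    rewrite trmx_delta map_delta_mx mulmxA -rowE -colE !mxE eqxx.
    by rewrite mulr1n.
  exact: psdX.
pose sd := map_mx sqrtC d.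
exists (diag_mx sd *m P).
rewrite {1}Xspec adjmxM tr_diag_mx map_diag_mx !mulmxA; congr (_ *m _).
rewrite -mulmxA mulmx_diag; congr (_ *m diag_mx _).
apply/rowP => i; rewrite !mxE -[LHS]sqrtCK expr2; congr (_ * _).
by apply/esym/CrealP; rewrite ger0_real // sqrtC_ge0.
Qed.

Lemma psd_obs (f : T -> R) : (forall t, 0 <= f t) -> psd (obs f).
Proof.
move=> f0 v.
suff -> : obs f = \sum_t ((f t)%:C *: (ket R t *m (ket R t)^t*)).
  rewrite mulmx_sumr mulmx_suml summxE; apply: sumr_ge0 => t _.
  rewrite -scalemxAr -scalemxAl mxE mulr_ge0 ?ler0c //.
  rewrite mulmxA -[_ *m _ *m v]mulmxA.
  have -> : v^t* *m ket R t = ((ket R t)^t* *m v)^t* by rewrite adjmxM trmxCK.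
  rewrite mxE big_ord1 !mxE mulrC; exact: mul_conjC_ge0.
have := obs_ketbra setT f.
rewrite (eq_bigl _ _ (fun t => in_setT t)) => ->.
by apply: eq_obs => t; rewrite in_setT.
Qed.

(** With X factored through [B], cyclicity turns the trace into a sum of values of the quadratic
    form of [Y]. *)
Lemma psd_trace X Y : psd X -> psd Y -> 0 <= \tr (X *m Y).
Proof.
move=> /psd_factor[B ->] psdY.
rewrite -mulmxA mxtrace_mulC mxtrace_entry; apply: sumr_ge0 => t _.
rewrite -entry_quad -[B in B *m Y]trmxCK.
have := psdY (B^t* *m ket R t).
by rewrite adjmxM !mulmxA.
Qed.

End Positivity.

(** * Tensoring an operator with the identity *)

Section Lift.

Variables (R : realType) (T S E : finType).
Variables (split : T -> S * E) (join : S * E -> T).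
Hypotheses (splitK : cancel split join) (joinK : cancel join split).
Implicit Types (X Y : Op R S).

Local Notation lift := (lift_op split).

Lemma entry_lift_op X s t :
  entry (lift X) s t
  = entry X (split s).1 (split t).1 * ((split s).2 == (split t).2)%:R.
Proof. exact: entry_op_of. Qed.

Lemma lift_opM X Y : lift (X *m Y) = lift X *m lift Y.
Proof.
apply: entryP => s t; rewrite entry_lift_op !entryM mulr_suml.
rewrite [RHS](reindex join) /=; last by apply: onW_bij; exists split.
under [RHS]eq_bigr => u _ do rewrite !entry_lift_op joinK.
rewrite -(pair_bigA _ (fun a b => entry X (split s).1 a * ((split s).2 == b)%:R
  * (entry Y a (split t).1 * (b == (split t).2)%:R))) /=.
apply: eq_bigr => a _; rewrite (bigD1 (split s).2) //= eqxx mulr1 mulrA.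
rewrite big1 ?addr0 // => b /negPf ne.
by rewrite eq_sym ne mulr0 mul0r.
Qed.

Lemma lift_op_adj X : lift (X^t*) = (lift X)^t*.
Proof.
apply: entryP => s t; rewrite entry_adj !entry_lift_op entry_adj rmorphM.
by rewrite rmorph_nat eq_sym.
Qed.

Lemma lift_opB X Y : lift (X - Y) = lift X - lift Y.
Proof.
by apply: entryP => s t; rewrite entryB !entry_lift_op entryB mulrBl.
Qed.

Lemma lift_op_obs (f : S -> R) : lift (obs f) = obs (fun t => f (split t).1).
Proof.
apply: entryP => s t; rewrite entry_lift_op !entry_obs -mulrA -natrM mulnb.
congr (_ * (nat_of_bool _)%:R); apply/andP/eqP => [[/eqP e1 /eqP e2]|->//].
by rewrite -[s]splitK -[t]splitK (surjective_pairing (split s)) e1 e2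
  -surjective_pairing.
Qed.

Lemma lift_op_id : lift (1%:M : Op R S) = 1%:M.
Proof. by rewrite -!obs_cst1 lift_op_obs. Qed.

(** Lifting is multiplicative and commutes with adjoints, so a factorization of [X] lifts. *)
Lemma psd_lift_op X : psd X -> psd (lift X).
Proof.
move=> /psd_factor[B ->]; rewrite lift_opM lift_op_adj => v.
rewrite mulmxA -adjmxM -mulmxA mxE; apply: sumr_ge0 => i _.
by rewrite !mxE mulrC mul_conjC_ge0.
Qed.

(** The isometry that tensors a vector of the first factor with the basis vector of [e]; [lift X]
    acts through it as [X]. *)
Definition ket_at (e : E) : 'M[R[i]]_(#|T|, #|S|) :=
  \matrix_(i, j) (enum_val i == join (enum_val j, e))%:R.

Lemma ket_at_ket e s : ket_at e *m ket R s = ket R (join (s, e)).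
Proof.
apply/matrixP => i j; rewrite /ket -colE !mxE enum_rankK ord1 eqxx andbT.
by rewrite (can2_eq enum_valK enum_rankK).
Qed.

Lemma lift_op_ket_at X e : lift X *m ket_at e = ket_at e *m X.
Proof.
apply/matrixP => i j; pose s := enum_val i; pose t := enum_val j.
have -> : (lift X *m ket_at e) i j = \sum_u entry (lift X) s u * (u == join (t, e))%:R.
  rewrite mxE (reindex (@enum_rank T)) /=; last first.
    by apply: (onW_bij _ (@enum_rank_bij T)).
  by apply: eq_bigr => u _; rewrite [ket_at _ _ _]mxE enum_rankK /entry enum_valK.
have -> : (ket_at e *m X) i j = \sum_u (s == join (u, e))%:R * entry X u t.
  rewrite mxE (reindex (@enum_rank S)) /=; last first.
    by apply: (onW_bij _ (@enum_rank_bij S)).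
  by apply: eq_bigr => u _; rewrite [ket_at _ _ _]mxE enum_rankK /entry enum_valK.
rewrite (bigD1 (join (t, e))) //= eqxx mulr1 big1 ?addr0; last first.
  by move=> u /negPf ->; rewrite mulr0.
rewrite entry_lift_op joinK /= (bigD1 (split s).1) //= big1 ?addr0; last first.
  move=> u /negPf ne; case: eqP => [sE|]; rewrite ?mul0r //.
  by rewrite sE joinK eqxx in ne.
rewrite mulrC; congr ((nat_of_bool _)%:R * _).
apply/eqP/eqP => [<-|->]; last by rewrite joinK.
by rewrite -surjective_pairing splitK.
Qed.

Lemma lift_op_ket X a b :
  lift X *m ket R (join (a, b)) = ket_at b *m (X *m ket R a).
Proof. by rewrite -ket_at_ket !mulmxA lift_op_ket_at. Qed.

End Lift.

(** * Regrouping the three registers *)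

Section Joins.

Variables A B M : finType.

Definition joinAM (p : A * M * B) : A * B * M := (p.1.1, p.2, p.1.2).
Definition joinBM (p : B * M * A) : A * B * M := (p.2, p.1.1, p.1.2).
Definition joinA (p : A * (B * M)) : A * B * M := (p.1, p.2.1, p.2.2).
Definition joinB (p : B * (A * M)) : A * B * M := (p.2.1, p.1, p.2.2).

Lemma splitAMK : cancel (@splitAM A B M) joinAM. Proof. by case=> -[]. Qed.
Lemma joinAMK : cancel joinAM (@splitAM A B M). Proof. by case=> -[]. Qed.
Lemma splitBMK : cancel (@splitBM A B M) joinBM. Proof. by case=> -[]. Qed.
Lemma joinBMK : cancel joinBM (@splitBM A B M). Proof. by case=> -[]. Qed.
Lemma splitAK : cancel (@splitA A B M) joinA. Proof. by case=> -[]. Qed.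
Lemma splitBK : cancel (@splitB A B M) joinB. Proof. by case=> -[]. Qed.
Lemma joinBK : cancel joinB (@splitB A B M). Proof. by case=> ? []. Qed.

End Joins.

(** * Weak duality for cheating probabilities *)

Section Cheating.

Variables (R : realType) (H M : finType).

(* Kitaev's dual certificate: [z] is the diagonal of the dual operator before
   the rounds of [view]; the cheater's rounds do not change it. *)
Fixpoint dual_feasible (win : H -> R) (view : seq (option (Op R (H * M)%type)))
    (z : H -> R) : Prop :=
  match view with
  | [::] => z =1 win
  | None :: view' => dual_feasible win view' z
  | Some X :: view' =>
      exists2 z' : H -> R, dual_feasible win view' z'
      & psd (obs (fun t : H * M => z t.1) - X^t* *m obs (fun t => z' t.1) *m X)
  end.

(** The dual operator lives on the honest register and the cheater acts on the other two; hence his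
    rounds impose no dual constraint. *)
Lemma lift_op_obs_comm (C : finType) (z : H -> R) (K : Op R (C * M)%type) :
  obs (fun t : H * C * M => z t.1.1) *m lift_op (@splitBM H C M) K
  = lift_op (@splitBM H C M) K *m obs (fun t : H * C * M => z t.1.1).
Proof.
apply: entryP => s t; rewrite entry_obsM entry_Mobs entry_lift_op /= mulrC.
by case: eqP => [->//|]; rewrite !mulr0 !mul0r.
Qed.

(** The expectation of the dual operator never increases along the run: honest rounds can only lower
    it by feasibility, and cheating rounds preserve it. *)
Lemma dual_bound (C : finType) (win : H -> R) (strat : nat -> seq (Op R (C * M)%type))
    (strat_ok : forall k, channel (strat k)) view k z (rho : Op R (H * C * M)%type) :
  dual_feasible win view z -> psd rho ->
  \tr (obs (fun t => win t.1.1) *m cheat_run strat k view rho)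
  <= \tr (obs (fun t : H * C * M => z t.1.1) *m rho).
Proof.
elim: view k z rho => [|[X|] view IH] k z rho /=.
- by move=> eq_z _; rewrite (eq_obs (g := fun t => z t.1.1)) // => t; rewrite eq_z.
- set Y := lift_op _ X => -[z' feas psdX] psd_rho.
  apply: le_trans (IH k.+1 z' _ feas (psd_conj _ psd_rho)) _.
  (* By cyclicity the loss of expectation is the trace of the lifted slack operator against [rho],
     and both are positive. *)
  rewrite mulmxA mxtrace_mulC !mulmxA -subr_ge0 -linearB /= -mulmxBl.
  apply: (psd_trace _ psd_rho).
  have := psd_lift_op (@splitAMK H C M) (@joinAMK H C M) psdX.
  rewrite lift_opB !(lift_opM (@splitAMK H C M) (@joinAMK H C M)) lift_op_adj.
  by rewrite !(lift_op_obs (@splitAMK H C M)).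
- move=> feas psd_rho.
  have psd_rho' : psd (\sum_(K <- strat k) lift_op (@splitBM H C M) K *m rho
                       *m (lift_op (@splitBM H C M) K)^t*).
    by apply: psd_sum => K; apply: psd_conj.
  apply: le_trans (IH k.+1 z _ feas psd_rho') _.
  rewrite mulmx_sumr linear_sum /=.
  (* Cyclicity and commutation bring each Kraus operator next to its adjoint, where the channel
     condition sums the products to the identity. *)
  under eq_bigr => K _ do rewrite mulmxA mxtrace_mulC !mulmxA -[X in X *m rho]mulmxA
    lift_op_obs_comm mulmxA -lift_op_adj
    -(lift_opM (@splitBMK H C M) (@joinBMK H C M)).
  rewrite -linear_sum /= -mulmx_suml -mulmx_suml.
  suff -> : \sum_(K <- strat k) lift_op (@splitBM H C M) (K^t* *m K) = 1%:M.
    by rewrite mul1mx.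
  rewrite -(lift_op_id R (@splitBMK H C M)) -(strat_ok k).
  elim/big_rec2: _ => [|K X Y _ ->].
    by apply: entryP => s t; rewrite entry_lift_op /entry !mxE mul0r.
  by apply: entryP => s t; rewrite entryD !entry_lift_op entryD mulrDl.
Qed.

(** The matrix [W] below tensors a vector of the cheater's space with the two pure states, so the
    initial state is [sigma] conjugated by it. *)
Lemma psd_cheat_initial (C : finType) (psiH : Ket R H) (psi : Ket R M)
    (sigma : Op R C) :
  psd sigma -> psd (cheat_initial psiH psi sigma).
Proof.
move=> psd_sigma.
pose W : 'M[R[i]]_(#|{: H * C * M}|, #|C|) := \matrix_(i, j)
  (kentry psiH (enum_val i).1.1 * kentry psi (enum_val i).2
   * ((enum_val i).1.2 == enum_val j)%:R).
suff -> : cheat_initial psiH psi sigma = W *m sigma *m W^t* by apply: psd_conj.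
apply/matrixP => i j; rewrite !mxE.
rewrite (bigD1 (enum_rank (enum_val j).1.2)) //= big1 ?addr0; last first.
  move=> c ne; rewrite !mxE eq_sym (can2_eq enum_valK enum_rankK) (negPf ne).
  by rewrite mulr0 rmorph0 mulr0.
rewrite !mxE (bigD1 (enum_rank (enum_val i).1.2)) //= big1 ?addr0; last first.
  move=> c ne; rewrite !mxE eq_sym (can2_eq enum_valK enum_rankK) (negPf ne).
  by rewrite mulr0 mul0r.
rewrite !mxE !enum_rankK !eqxx !mulr1 /entry !mxE !big_ord1 !mxE /kentry rmorphM /=.
set a := psiH _ _; set b := psi _ _; set c := Num.conj _; set d := Num.conj _.
rewrite -!mulrA; congr (_ * _); rewrite mulrCA [RHS]mulrCA; congr (_ * _).
exact: mulrCA.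
Qed.

(** The honest register starts in the basis state [h], so the initial expectation of the dual
    operator is [z h] times the trace of [sigma], which is 1. *)
Lemma cheat_value_le (h : H) (m : M) view (win z : H -> R) :
  dual_feasible win view z ->
  (cheat_value (ket R h) (ket R m) view (obs win) <= (z h)%:E)%E.
Proof.
move=> feas; apply: ge_ereal_sup => _ [d [sigma [strat [[psd_s tr_s] strat_ok ->]]]].
rewrite lee_fin (lift_op_obs (@splitAK _ _ _)) /=.
have := dual_bound strat_ok 0 feas (psd_cheat_initial (ket R h) (ket R m) psd_s).
set t1 := \tr _; suff -> : \tr (obs (fun t => z t.1.1)
    *m cheat_initial (ket R h) (ket R m) sigma) = (z h)%:C.
  by case: t1 => a b; rewrite lecE /= => /andP[].
rewrite mxtrace_entry.
under eq_bigr => s _ do rewrite entry_obsM entry_op_of !entry_ketbra !andbb.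
rewrite (eq_bigr (fun s : H * 'I_d * M => (z h)%:C
    * ((s.1.1 == h)%:R * entry sigma s.1.2 s.1.2 * (s.2 == m)%:R))); last first.
  by move=> s _; case: eqP => [->//|]; rewrite !(mul0r, mulr0).
transitivity ((z h)%:C * \tr sigma); last by rewrite tr_s mulr1.
rewrite -mulr_sumr mxtrace_entry; congr (_ * _).
(* Putting the cheater's index outermost leaves an inner sum over the other two registers with the
   single nonzero term (h, m). *)
rewrite (reindex (@joinB H 'I_d M)) /=; last first.
  by apply: onW_bij; exists (@splitB _ _ _); [apply: joinBK|apply: splitBK].
transitivity (\sum_c \sum_p (p.1 == h)%:R * entry sigma c c * (p.2 == m)%:R).
  by rewrite pair_bigA.
apply: eq_bigr => c _; rewrite (bigD1 (h, m)) //= !eqxx mul1r mulr1.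
rewrite big1 ?addr0 // => -[h' m'] ne /=.
by move: ne; rewrite xpair_eqE; case: eqP; case: eqP; rewrite ?(mul0r, mulr0).
Qed.

End Cheating.

(** * The conditional swap, the label projector and the rotation *)

Section Gates.

Variables (R : realType) (L : finType).
Local Notation reg := (option L).
Implicit Types (S : {set L}) (U : Op R L) (i : L) (p : reg * reg).

Lemma mx_ketP m (T : finType) (X Y : 'M[R[i]]_(m, #|{: T}|)) :
  (forall t, X *m ket R t = Y *m ket R t) -> X = Y.
Proof.
move=> eqXY; apply/matrixP => i j; have := eqXY (enum_val j).
by rewrite /ket enum_valK -!colE => /matrixP/(_ i 0); rewrite !mxE.
Qed.

(** The conditional swap permutes the basis; this is the permutation, so conjugating a diagonal
    operator by the gate merely relabels its entries. *)
Definition swap_labels S p : reg * reg :=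
  let D := (None |: [set Some i | i in S])%SET in
  if (p.1 \in D) && (p.2 \in D) then (p.2, p.1) else p.

Lemma swap_labelsK S : involutive (swap_labels S).
Proof.
case=> a b; rewrite /swap_labels /=; set D := (None |: _)%SET.
case E: ((a \in D) && (b \in D)) => /=.
  by rewrite andbC E.
by rewrite E.
Qed.

Lemma entry_swap_op S p q : entry (swap_op R S) p q = (p == swap_labels S q)%:R.
Proof. exact: entry_op_of. Qed.

Lemma swap_op_ket S p : swap_op R S *m ket R p = ket R (swap_labels S p).
Proof. by apply: ketP => q; rewrite kentryMket entry_swap_op kentry_ket. Qed.

Lemma adj_swap_op S : (swap_op R S)^t* = swap_op R S.
Proof.
apply: entryP => p q; rewrite entry_adj !entry_swap_op rmorph_nat.
by rewrite eq_sym (can2_eq (swap_labelsK S) (swap_labelsK S)).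
Qed.

Lemma swap_op_obs S (f : reg * reg -> R) :
  swap_op R S *m obs f *m swap_op R S = obs (fun p => f (swap_labels S p)).
Proof.
apply: mx_ketP => p; rewrite -!mulmxA swap_op_ket !obs_ket -scalemxAr.
by rewrite swap_op_ket swap_labelsK.
Qed.

Lemma swap_op_unitary S : swap_op R S \is unitarymx.
Proof.
apply/unitarymxP; rewrite adj_swap_op; apply: mx_ketP => p.
by rewrite -mulmxA !swap_op_ket swap_labelsK mul1mx.
Qed.

(** The idle state gets the default 0, in agreement with the label projectors, which reject it. *)
Definition on_label (f : L -> R) (a : reg) : R := oapp f 0 a.

Lemma label_proj_obs S :
  label_proj R S = obs (fun p => on_label (fun i => (i \in S)%:R) p.1).
Proof.
rewrite /label_proj proj_obs (@lift_op_obs _ _ _ _ id id) //.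
apply: eq_obs => -[[i|] b] /=.
  by rewrite mem_imset //; apply: Some_inj.
by case: imsetP => // -[].
Qed.

Lemma label_proj_projective S : projective (label_proj R S).
Proof.
rewrite label_proj_obs; split; first exact: adj_obs.
rewrite obsM; apply: eq_obs => -[[i|] b] /=; last by rewrite mulr0.
by case: (i \in S); rewrite ?mulr1 ?mulr0.
Qed.

Lemma dup_ket S i :
  dup R S *m ket R i = (i \in S)%:R *: ket R (Some i, Some i).
Proof.
rewrite /dup mulmx_suml; have [iS|iS] := boolP (i \in S); last first.
  rewrite scale0r big1 // => j jS; rewrite -mulmxA adj_ket_ket.
  by case: eqVneq jS iS => [->->|]; rewrite // mul_mx_scalar scale0r.
rewrite (bigD1 i) //= big1 ?addr0 => [|j /andP[_ /negPf ne]].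
  by rewrite -mulmxA adj_ket_ket eqxx mul_mx_scalar.
by rewrite -mulmxA adj_ket_ket ne mul_mx_scalar scale0r.
Qed.

Definition is_dup S p : bool := (p.1 == p.2) && oapp (mem S) false p.1.

Lemma adj_dup_ket S p :
  (dup R S)^t* *m ket R p = oapp (fun i => (is_dup S p)%:R *: ket R i) 0 p.1.
Proof.
rewrite /dup adjmx_sum mulmx_suml.
have kb i : (ket R (Some i, Some i) *m (ket R i)^t*)^t* *m ket R p
          = ((Some i, Some i) == p)%:R *: ket R i.
  by rewrite adjmxM trmxCK -mulmxA adj_ket_ket mul_mx_scalar.
rewrite (eq_bigr _ (fun i _ => kb i)) /is_dup.
case: p {kb} => -[i|] b /=; last by rewrite big1 // => i _; rewrite scale0r.
have [<-|ne] /= := eqVneq (Some i) b; last first.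
  rewrite scale0r big1 // => j _; rewrite xpair_eqE.
  by case: eqP => [->|_]; rewrite ?(negPf ne) ?andbF scale0r.
have [iS|iS] := boolP (i \in S).
  rewrite (bigD1 i) //= eqxx big1 ?addr0 // => j /andP[_ /negPf ne].
  by rewrite xpair_eqE (inj_eq Some_inj) ne scale0r.
rewrite scale0r big1 // => j jS; rewrite xpair_eqE (inj_eq Some_inj).
by case: eqVneq jS iS => [->->|]; rewrite // scale0r.
Qed.

Lemma obs_dup S (f : reg * reg -> R) :
  obs f *m dup R S = dup R S *m obs (fun i => f (Some i, Some i)).
Proof.
apply: mx_ketP => i; rewrite -!mulmxA obs_ket -scalemxAr !dup_ket.
by rewrite -scalemxAr obs_ket scalerA mulrC -scalerA.
Qed.

Lemma adj_dup_obs S (f : reg * reg -> R) :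
  (dup R S)^t* *m obs f = obs (fun i => f (Some i, Some i)) *m (dup R S)^t*.
Proof. by rewrite -[obs f]adj_obs -adjmxM obs_dup adjmxM adj_obs. Qed.

Lemma adj_dup_dup S : (dup R S)^t* *m dup R S = proj R S.
Proof.
apply: mx_ketP => i; rewrite proj_obs obs_ket -mulmxA dup_ket -scalemxAr adj_dup_ket.
rewrite /is_dup /= eqxx /=; case: (i \in S); last by rewrite !scale0r.
by rewrite !scale1r.
Qed.

Lemma dup_adj_dup S : dup R S *m (dup R S)^t* = obs (fun p => (is_dup S p)%:R).
Proof.
apply: mx_ketP => -[a b]; rewrite obs_ket -mulmxA adj_dup_ket rmorph_nat.
case: a => [i|] /=; last by rewrite mulmx0 /is_dup andbF scale0r.
rewrite -scalemxAr dup_ket scalerA /is_dup /=; case: eqP => [<-|] /=.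
  by case: (i \in S); rewrite ?mul0r ?scale0r // mulr1.
by rewrite mul0r !scale0r.
Qed.

Lemma dup_obs S (f g : L -> R) :
  {in S, f =1 g} -> dup R S *m obs f = dup R S *m obs g.
Proof.
move=> eqfg; apply: mx_ketP => i; rewrite -!mulmxA !obs_ket -!scalemxAr dup_ket.
by have [/eqfg->|] := boolP (i \in S); rewrite ?scale0r ?scaler0.
Qed.

Lemma dup_proj S : dup R S *m proj R S = dup R S.
Proof.
rewrite proj_obs (@dup_obs _ _ (fun=> 1)) ?obs_cst1 ?mulmx1 // => i ->.
by [].
Qed.

Lemma proj_adj_dup S : proj R S *m (dup R S)^t* = (dup R S)^t*.
Proof. by rewrite -{2}(dup_proj S) adjmxM proj_obs adj_obs. Qed.

Section DiagOp.

Variables (S : {set L}) (U : Op R L).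
Hypothesis unitU : unitary_on S U.

(** The defect [X] below satisfies X X* = 0, because U U* is the projector itself; the diagonal
    entries of X X* are sums of squared moduli of the rows, so [X] vanishes. *)
Lemma proj_unitary : proj R S *m U = U.
Proof.
have projK : proj R S *m proj R S = proj R S.
  by rewrite proj_obs obsM; apply: eq_obs => i; rewrite -natrM mulnb andbb.
have [UU' U'U] := unitU.
pose X := proj R S *m U - U.
suff: X *m X^t* = 0.
  move=> XX0; apply: subr0_eq; rewrite -/X.
  apply/matrixP => i j; rewrite [RHS]mxE.
  have /eqP := congr1 (fun Y : Op R L => Y i i) XX0; rewrite [X in _ == X]mxE mxE.
  rewrite psumr_eq0 => [/allP/(_ j)|k _]; rewrite !mxE; last exact: mul_conjC_ge0.
  by rewrite mem_index_enum mul_conjC_eq0 => /(_ isT)/eqP.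
have pH : (proj R S)^t* = proj R S by rewrite proj_obs adj_obs.
rewrite /X adjmxB adjmxM pH mulmxBl !mulmxBr !mulmxA -![_ *m U *m _]mulmxA U'U.
by rewrite !projK !subrr.
Qed.

Lemma adj_unitary_proj : U^t* *m proj R S = U^t*.
Proof.
by rewrite -[in RHS]proj_unitary adjmxM proj_obs adj_obs.
Qed.

Lemma unitary_proj : U *m proj R S = U.
Proof.
by have [<- _] := unitU; have [_ U'U] := unitU; rewrite mulmxA U'U proj_unitary.
Qed.

Lemma proj_adj_unitary : proj R S *m U^t* = U^t*.
Proof.
by rewrite -[in RHS]unitary_proj adjmxM proj_obs adj_obs.
Qed.

Let W := dup R S.

Lemma adj_diag_op :
  (diag_op S U)^t* = W *m U^t* *m W^t* + (1%:M - W *m W^t*).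
Proof. by rewrite /diag_op adjmxD adjmxB adjmx1 !adjmxM trmxCK mulmxA. Qed.

(** A diagonal operator preserves both the duplicated span and its complement, so the cross terms
    vanish: the first block is rotated by [U], the second is left as it was. *)
Lemma diag_op_obs (f : reg * reg -> R) :
  diag_op S U *m obs f *m (diag_op S U)^t*
  = W *m (U *m obs (fun i => f (Some i, Some i)) *m U^t*) *m W^t*
    + obs (fun p => f p * (~~ is_dup S p)%:R).
Proof.
rewrite adj_diag_op /diag_op -/W.
have W'C : W^t* *m (1%:M - W *m W^t*) = 0.
  by rewrite mulmxBr mulmx1 mulmxA adj_dup_dup proj_adj_dup subrr.
have CW : (1%:M - W *m W^t*) *m W = 0.
  by rewrite mulmxBl mul1mx -mulmxA adj_dup_dup dup_proj subrr.
have WW' : W^t* *m W = proj R S := adj_dup_dup S.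
(* The complement is made opaque so that distributivity does not expand it. *)
have [C CE] : exists C, C = 1%:M - W *m W^t* by exists (1%:M - W *m W^t*).
rewrite -CE in W'C CW *.
rewrite mulmxDl mulmxDr !mulmxDl.
have -> : W *m U *m W^t* *m obs f *m (W *m U^t* *m W^t*)
        = W *m (U *m obs (fun i => f (Some i, Some i)) *m U^t*) *m W^t*.
  rewrite -![_ *m W^t* *m obs f]mulmxA adj_dup_obs -!mulmxA [W^t* *m (W *m _)]mulmxA.
  by rewrite WW' [proj R S *m _]mulmxA proj_adj_unitary.
have -> : C *m obs f *m (W *m U^t* *m W^t*) = 0.
  by rewrite -!mulmxA [obs f *m (W *m _)]mulmxA obs_dup !mulmxA CW !mul0mx.
have -> : W *m U *m W^t* *m obs f *m C = 0.
  by rewrite -![_ *m W^t* *m obs f]mulmxA adj_dup_obs -!mulmxA W'C !mulmx0.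
rewrite addr0 add0r; congr (_ + _).
rewrite CE dup_adj_dup -obs_cst1 obsB !obsM; apply: eq_obs => p.
by case: is_dup; rewrite /= ?subrr ?subr0 ?mulr0 ?mul1r.
Qed.

Lemma diag_op_unitary : diag_op S U \is unitarymx.
Proof.
apply/unitarymxP; have := diag_op_obs (fun=> 1).
rewrite !obs_cst1 !mulmx1 => ->; have [_ ->] := unitU.
rewrite dup_proj dup_adj_dup; apply: entryP => p q.
rewrite entryD !entry_obs entry1 -mulrDl; case: is_dup => /=;
  by rewrite ?mulr0 ?mulr1 ?addr0 ?add0r mul1r.
Qed.

Lemma adj_diag_op_dup : (diag_op S U)^t* *m dup R S = dup R S *m U^t*.
Proof.
rewrite adj_diag_op mulmxDl mulmxBl mul1mx -!mulmxA !adj_dup_dup.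
by rewrite dup_proj subrr addr0 adj_unitary_proj.
Qed.

Lemma adj_diag_op_ket p : ~~ is_dup S p -> (diag_op S U)^t* *m ket R p = ket R p.
Proof.
move=> ndup; rewrite adj_diag_op mulmxDl mulmxBl mul1mx -!mulmxA.
have -> : W^t* *m ket R p = 0.
  by rewrite adj_dup_ket (negPf ndup); case: p.1 => //= i; rewrite scale0r.
by rewrite !mulmx0 subr0 add0r.
Qed.

End DiagOp.

End Gates.

(** * Dual inequalities for one honest action *)

Section Dual.

Variables (R : realType) (L : finType).
Local Notation reg := (option L).
Implicit Types (z : reg -> R).

(** Everything involved is diagonal up to a basis permutation, so the operator inequality is a
    pointwise one; [e] is the diagonal of the measured projector. *)
Lemma swap_step_psd (S : {set L}) (e : reg * reg -> R) z z'
    (X : Op R (reg * reg)%type) :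
  X = (swap_op R S)^t* *m obs e ->
  (forall p, e p * z' (swap_labels S p).1 * e p <= z p.1) ->
  psd (obs (fun p => z p.1) - X^t* *m obs (fun p => z' p.1) *m X).
Proof.
move=> -> le_z; rewrite adjmxM trmxCK adj_obs adj_swap_op.
have -> : obs e *m swap_op R S *m obs (fun p => z' p.1) *m (swap_op R S *m obs e)
        = obs e *m (swap_op R S *m obs (fun p => z' p.1) *m swap_op R S) *m obs e.
  by rewrite !mulmxA.
rewrite swap_op_obs !obsM obsB; apply: psd_obs => p.
by rewrite subr_ge0.
Qed.

Lemma mulmx_intertwine (C : pzRingType) m n (E : 'M[C]_m) (W : 'M[C]_(m, n))
    (V : 'M[C]_(n, m)) (P A : 'M[C]_n) :
  E *m W = W *m P -> V *m E = P *m V ->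
  E *m (W *m A *m V) *m E = W *m (P *m A *m P) *m V.
Proof. by move=> EW VE; rewrite !mulmxA EW -!mulmxA VE. Qed.

(** The slack splits into two positive parts: the assumed operator inequality transported by [dup],
    and a diagonal remainder. The dual value of final labels after the step is 0, as these labels
    are absent from the earlier frame. *)
Lemma unitary_step_psd (g h k : {set L}) U (x y : L -> R) z z' :
  unitary_on (g :|: h) U ->
  psd (\sum_(i in h) (y i)%:C *: (ket R i *m (ket R i)^t*)
       - \sum_(i in g) (x i)%:C *:
           (proj R h *m U *m (ket R i *m (ket R i)^t*) *m U^t* *m proj R h)) ->
  [disjoint g & h] -> [disjoint g & k] -> [disjoint h & k] ->
  (forall a, 0 <= z a) ->
  {in h, forall i, z (Some i) = y i} ->
  {in k, forall i, z (Some i) = z' (Some i)} ->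
  {in g, forall i, z' (Some i) = x i} ->
  {in h, forall i, z' (Some i) = 0} ->
  let X := (diag_op (g :|: h) U)^t* *m label_proj R (h :|: k) in
  psd (obs (fun p => z p.1) - X^t* *m obs (fun p => z' p.1) *m X).
Proof.
move=> unitU psdU gh gk hk z_ge0 zh zk z'g z'h X.
set S := g :|: h in unitU X *.
pose e p : R := on_label (fun i => (i \in h :|: k)%:R) (p : reg * reg).1.
have XE : X^t* *m obs (fun p => z' p.1) *m X
  = dup R S *m (proj R h *m (U *m obs (fun i => x i *+ (i \in g)) *m U^t*)
                *m proj R h) *m (dup R S)^t*
    + obs (fun p => e p * (z' p.1 * (~~ is_dup S p)%:R) * e p).
  rewrite /X adjmxM trmxCK label_proj_obs adj_obs -/e.
  set V := diag_op S U.
  have -> : obs e *m V *m obs (fun p => z' p.1) *m (V^t* *m obs e)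
     = obs e *m (V *m obs (fun p => z' p.1) *m V^t*) *m obs e by rewrite !mulmxA.
  rewrite diag_op_obs // mulmxDr mulmxDl !obsM; congr (_ + _).
  (* Among the duplicated labels the measurement keeps exactly the final ones, since initial labels
     are neither final nor unchanged; this produces the projector [E_h] of the hypothesis. *)
  have eW : obs e *m dup R S = dup R S *m proj R h.
    rewrite obs_dup proj_obs; apply: dup_obs => i iS; rewrite /e /= !inE.
    move: iS; rewrite !inE; case: (boolP (i \in h)) => //= _; rewrite orbF => ig.
    by rewrite (disjointFr gk ig).
  have We : (dup R S)^t* *m obs e = proj R h *m (dup R S)^t*.
    by rewrite -[obs e]adj_obs -adjmxM eW adjmxM proj_obs adj_obs.
  (* Since [U] only sees the labels of [S], the values of [z'] there are all that matters. *)
  have UE : U *m obs (fun i => z' (Some i, Some i : reg).1)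
          = U *m obs (fun i => x i *+ (i \in g)).
    rewrite -(unitary_proj unitU) -!mulmxA; congr (_ *m _).
    rewrite proj_obs !obsM; apply: eq_obs => i; rewrite !inE /=.
    have [ig|ig] := boolP (i \in g); first by rewrite !mul1r mulr1n z'g.
    case: (boolP (i \in h)) => [/z'h->|_]; first by rewrite !mulr0.
    by rewrite !mul0r.
  by rewrite (mulmx_intertwine _ eW We) UE.
pose xU := proj R h *m (U *m obs (fun i => x i *+ (i \in g)) *m U^t*) *m proj R h.
have hypE : \sum_(i in h) (y i)%:C *: (ket R i *m (ket R i)^t*)
       - \sum_(i in g) (x i)%:C *:
           (proj R h *m U *m (ket R i *m (ket R i)^t*) *m U^t* *m proj R h)
  = obs (fun i => y i *+ (i \in h)) - xU.
  rewrite obs_ketbra; congr (_ - _).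
  rewrite /xU -obs_ketbra; move: (proj R h) => Ph.
  rewrite mulmx_sumr mulmx_suml mulmx_sumr mulmx_suml.
  by apply: eq_bigr => i _; rewrite -!(scalemxAr, scalemxAl) !mulmxA.
rewrite XE -/xU.
(* The share of [z] that the operator inequality consumes: the final coordinates on the duplicated
   span. *)
pose yd (p : reg * reg) : R :=
  on_label (fun i => y i *+ (i \in h)) p.1 * (is_dup S p)%:R.
have -> : obs (fun p : reg * reg => z p.1)
    = dup R S *m obs (fun i => y i *+ (i \in h)) *m (dup R S)^t*
      + obs (fun p => z p.1 - yd p).
  rewrite -obsB addrCA -[LHS]addr0; congr (_ + _).
  have -> : obs yd
      = obs (fun p : reg * reg => on_label (fun i => y i *+ (i \in h)) p.1)
        *m (dup R S *m (dup R S)^t*).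
    by rewrite dup_adj_dup obsM.
  by rewrite mulmxA obs_dup subrr.
rewrite opprD addrACA -mulmxBl -mulmxBr obsB -hypE.
apply: psdD; first exact: psd_conj.
(* In the remainder, unchanged labels cancel, final ones leave 0 or their own value of [z], and all
   others are rejected and leave [z]. *)
apply: psd_obs => -[[i|] b]; rewrite /yd /e /=; last by rewrite !mul0r !subr0.
rewrite !inE; have [ih|ih] := boolP (i \in h).
  rewrite z'h // mul0r mulr0 mul0r subr0 zh //= mulr1n.
  by case: is_dup; rewrite ?mulr1 ?subrr // mulr0 subr0 -zh.
rewrite mulr0n mul0r subr0 /=; have [ik|ik] := boolP (i \in k); last first.
  by rewrite mulr0 subr0.
rewrite mul1r mulr1 zk // /is_dup /= !inE (negPf ih) orbF.
have -> : (i \in g) = false by exact: disjointFl gk ik.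
by rewrite andbF mulr1 subrr.
Qed.

End Dual.

(** * Dual feasibility along the point game *)

Section Transitions.

Variables (R : realType) (L : finType) (G : point_game R L) (U : nat -> Op R L).
Variables (alpha beta : R).
Hypothesis gameG : is_tdpg G beta alpha.
Hypothesis goodU : forall j, (j < len G)%N -> good_unitary G j (U j).
Local Notation reg := (option L).

(** The three actions follow the direction of the point game; the protocol runs their adjoints,
    starting from [last_swap]. *)
Definition first_swap j : action R (reg * reg)%type :=
  Action (swap_op R (gs G j)) 1%:M false.
Definition rotation j : action R (reg * reg)%type :=
  Action (diag_op (gs G j :|: hs G j) (U j)) (label_proj R (hs G j :|: ks G j)) false.
Definition last_swap j : action R (reg * reg)%type :=
  Action (swap_op R (hs G j)) (label_proj R (hs G j :|: ks G j)) false.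

Lemma transition_sets j : (j < len G)%N ->
  [/\ [disjoint gs G j & hs G j], [disjoint gs G j & ks G j],
      [disjoint hs G j & ks G j], pts (frm G j) = gs G j :|: ks G j
    & pts (frm G j.+1) = hs G j :|: ks G j].
Proof.
case: gameG => _ ok _ _ /ok[[gsub hdis ptsE] _ _ _ _].
have ksub : ks G j \subset pts (frm G j) by exact: subsetDl.
split=> //; first by rewrite disjoint_sym (disjointWr gsub).
- by rewrite disjoints_subset /ks setCD subsetUr.
- exact: disjointWr ksub hdis.
- by apply/setP => i; rewrite !inE; case: (boolP (i \in gs G j)) => // /(subsetP gsub).
Qed.

(** The diagonal of the dual operator at frame [j], extended by 0 to the idle state and to labels
    absent from the frame. *)
Definition coord_obs (d : direction) j (a : reg) : R :=
  on_label (fun i => along d (pos (frm G j) i) *+ (i \in pts (frm G j))) a.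

Lemma coord_obs_ge0 d j a : (j <= len G)%N -> 0 <= coord_obs d j a.
Proof.
case: gameG => ok _ _ _ /ok frame_j; case: a => [i|] //=.
have [/frame_j[x0 y0 _]|_] := boolP (i \in _); last by rewrite mulr0n.
by case: d.
Qed.

Definition same_direction (d d' : direction) : bool :=
  match d, d' with
  | Horizontal, Horizontal | Vertical, Vertical => true
  | _, _ => false
  end.

(* What the honest player sees of the last [n] transitions, undone in reverse
   order, when [d] is the direction in which he or she performs the rotation. *)
Fixpoint honest_view d n : seq (option (Op R (reg * reg)%type)) :=
  if n is j.+1 then
    (if same_direction (dir G j) d then
       [:: None; Some (passed (adj_action (rotation j))); None]
     else [:: Some (passed (adj_action (last_swap j))); None;
              Some (passed (adj_action (first_swap j)))])
    ++ honest_view d j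
  else [::].

(** Induction on the number of transitions still to be undone. A transition in direction [d] is a
    single honest step given by [unitary_step_psd]; in the other direction two honest swaps enclose
    a cheating round, and an intermediate diagonal is needed. *)
Lemma honest_view_feasible d n win :
  coord_obs d 0 =1 win -> (n <= len G)%N ->
  dual_feasible win (honest_view d n) (coord_obs d n).
Proof.
move=> win0; elim: n => [_ //|j IH ltj] /=.
have {}IH := IH (ltnW ltj).
have [gh gk hk ptsj ptsj1] := transition_sets ltj.
have [ok /(_ j ltj)[_ keep [c [gc hc]] _ _] _ _] := gameG.
have kE (i : L) : i \in ks G j -> coord_obs d j.+1 (Some i) = coord_obs d j (Some i).
  by move=> ik; rewrite /= ptsj ptsj1 !in_setU ik !orbT; case: (keep i ik) => ->.
case: ifP => /= dd.
  have dE : dir G j = d by move: dd; case: d (dir G j) {IH win0 kE} => [] [].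
  exists (coord_obs d j) => //.
  have [unitU _ psdU] := goodU ltj.
  apply: (unitary_step_psd unitU psdU) => // [a|i ih|i ig|i ih].
  - exact: coord_obs_ge0.
  - by rewrite /= ptsj1 inE ih mulr1n /xh dE.
  - by rewrite /= ptsj inE ig mulr1n /xg dE.
  - rewrite /= ptsj inE.
    by rewrite (disjointFl gh ih) (disjointFr hk ih) mulr0n.
have acrossE : along d =1 across (dir G j).
  by move: dd; case: d (dir G j) {IH win0 kE} => [] [].
(* M may come back from the cheater in any state, so the idle state gets the
   weight c too; c may be negative only if no point moves. *)
pose c' := Num.max c 0.
(* The dual diagonal between the swaps has to dominate the coordinates of frame [j] and whatever the
   second inverse swap may bring in; final labels can be given 0. *)
pose z' (a : reg) : R :=
  if a is Some i then
    if i \in gs G j then c' else if i \in ks G j then coord_obs d j a else 0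
  else c'.
have c'0 : 0 <= c' by rewrite /c' le_max lexx orbT.
have z'0 a : 0 <= z' a.
  case: a => [i|] //; rewrite /z'; case: ifP => // _; case: ifP => // _.
  exact: coord_obs_ge0 (ltnW ltj).
have memD (S : {set L}) (a : reg) :
  (a \in None |: [set Some i | i in S])%SET = oapp (mem S) true a.
  rewrite in_setU1; case: a => [i|] //=; rewrite mem_imset //; exact: Some_inj.
have ng i : i \in hs G j -> z' (Some i) = 0.
  by move=> ih; rewrite /= (disjointFl gh ih) (disjointFr hk ih).
have le_gc (a : reg) : oapp (mem (gs G j)) true a -> coord_obs d j a <= c'.
  case: a => [i|] //= ig; rewrite ptsj inE ig mulr1n acrossE (gc i ig).
  by rewrite /c' le_max lexx.
have le_z' (a : reg) : coord_obs d j a <= z' a.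
  case: a => [i|] //; have [ig|ig] := boolP (i \in gs G j).
    by rewrite /z' ig; apply: le_gc.
  rewrite /z' (negPf ig); case: (boolP (i \in ks G j)) => // ik.
  by rewrite /= ptsj in_setU (negPf ig) (negPf ik).
exists z'; first exists (coord_obs d j) => //.
(* Undoing [first_swap]: when a swap occurs, the outgoing content had value [c'] and the incoming
   one has coordinate at most [c']. *)
- apply: (@swap_step_psd _ _ (gs G j) (fun=> 1)); first by rewrite obs_cst1.
  move=> [a b]; rewrite mul1r mulr1 /swap_labels !memD.
  case: ifP => [/andP[aD bD]|_] //=; apply: le_trans (le_gc b bD) _.
  by case: a aD {bD} => [i|] //= ->.
(* Undoing [last_swap]: the measurement leaves unchanged labels, whose values agree, and final
   labels, which may be exchanged for the idle state of value [c']. *)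
- pose e (p : reg * reg) : R := on_label (fun i => (i \in hs G j :|: ks G j)%:R) p.1.
  apply: (@swap_step_psd _ _ (hs G j) e); first by rewrite -label_proj_obs.
  move=> [[i|] b]; rewrite /e /swap_labels !memD /=; last by rewrite !mul0r.
  have [ihk|ihk] := boolP (i \in hs G j :|: ks G j); last first.
    by rewrite !mul0r; have := @coord_obs_ge0 d j.+1 (Some i) ltj.
  rewrite mul1r mulr1 -/(coord_obs d j.+1 (Some i)).
  have [ih|ih] := boolP (i \in hs G j); last first.
    have ik : i \in ks G j by move: ihk; rewrite inE (negPf ih).
    rewrite /= ik (disjointFl gk ik) ptsj1 ihk; have := kE _ ik.
    by rewrite /= ptsj1 ihk ptsj inE ik orbT => ->.
  (* An actual final point lies on the line, so its coordinate [c] is nonnegative and the maximum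
     with 0 changes nothing. *)
  have cE : coord_obs d j.+1 (Some i) = c'.
    rewrite /= ptsj1 ihk acrossE (hc _ ih) mulr1n /c' max_l //.
    have := @coord_obs_ge0 d j.+1 (Some i) ltj.
    by rewrite /= ptsj1 ihk acrossE (hc _ ih).
  rewrite [X in _ <= X]cE; case: ifP => [/= bh|_]; last by rewrite [z' _]ng.
  by case: b bh => [i'|] //= bh; have := ng i' bh => /= ->.
Qed.

End Transitions.

(** * Honest evolution through one transition *)

Section HonestTransition.

Variables (R : realType) (L : finType) (G : point_game R L) (U : nat -> Op R L).
Variables (alpha beta : R) (j : nat).
Hypothesis gameG : is_tdpg G beta alpha.
Hypothesis ltj : (j < len G)%N.
Hypothesis goodU : good_unitary G j (U j).
Local Notation reg := (option L).

(** Index 1 refers to the player who swaps and index 2 to the one who rotates, so that one argument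
    serves both directions; [joinE] says that the two groupings differ by exchanging the private
    registers. *)
Variables (T : finType) (split1 split2 : T -> reg * reg * reg).
Variables (join1 join2 : reg * reg * reg -> T).
Hypotheses (split1K : cancel split1 join1) (join1K : cancel join1 split1).
Hypotheses (split2K : cancel split2 join2) (join2K : cancel join2 split2).
Hypothesis joinE : forall a b m, join2 (a, m, b) = join1 (b, m, a).

Definition amplitude n i : R[i] := (Num.sqrt (wt (frm G n) i))%:C.

Definition canonical_ket n : Ket R T :=
  \sum_(i in pts (frm G n)) amplitude n i *: ket R (join1 (Some i, None, Some i)).

(** The state between the two swaps: for labels in [S] the copy of the swapping player sits in the
    message, so the rotating player holds both copies. *)
Definition moved_ket (S : {set L}) n : Ket R T :=
  \sum_(i in pts (frm G n)) amplitude n i *: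
    ket R (if i \in S then join1 (None, Some i, Some i)
           else join1 (Some i, None, Some i)).

Lemma lift_swap_canonical S n :
  lift_op split1 (swap_op R S) *m canonical_ket n = moved_ket S n.
Proof.
rewrite mulmx_sumr; apply: eq_bigr => i _; rewrite -scalemxAr; congr (_ *: _).
rewrite (lift_op_ket split1K join1K) swap_op_ket ket_at_ket /swap_labels.
rewrite !in_setU1 /= mem_imset; last exact: Some_inj.
by rewrite andbT; case: (i \in S).
Qed.

Lemma lift_swap_moved S n :
  lift_op split1 (swap_op R S) *m moved_ket S n = canonical_ket n.
Proof.
rewrite -lift_swap_canonical mulmxA -(lift_opM split1K join1K).
have /unitarymxP := @swap_op_unitary R L S; rewrite adj_swap_op => ->.
by rewrite (lift_op_id R split1K) mul1mx.
Qed.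

Let E := label_proj R (hs G j :|: ks G j).

Lemma lift_label_proj_canonical :
  lift_op split1 E *m canonical_ket j.+1 = canonical_ket j.+1.
Proof.
have [_ _ _ _ pE] := transition_sets gameG ltj.
rewrite mulmx_sumr; apply: eq_bigr => i; rewrite pE => ihk.
rewrite -scalemxAr; congr (_ *: _).
rewrite (lift_op_ket split1K join1K) /E label_proj_obs obs_ket /= ihk.
by rewrite scale1r ket_at_ket.
Qed.

Lemma lift_label_proj_moved :
  lift_op split2 E *m moved_ket (hs G j) j.+1 = moved_ket (hs G j) j.+1.
Proof.
have [_ _ _ _ pE] := transition_sets gameG ltj.
rewrite mulmx_sumr; apply: eq_bigr => i; rewrite pE => ihk.
rewrite -scalemxAr; congr (_ *: _); rewrite -!joinE.
have ketE m b : lift_op split2 E *m ket R (join2 (Some i, m, b))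
              = ket R (join2 (Some i, m, b)).
  rewrite (lift_op_ket split2K join2K) /E label_proj_obs obs_ket /= ihk.
  by rewrite scale1r ket_at_ket.
by case: ifP.
Qed.

Lemma weight_ketE (S : {set L}) (p : L -> R) : {in S, forall i, 0 < p i} ->
  \sum_(i in S) (Num.sqrt (p i))%:C *: ket R i
  = (Num.sqrt (\sum_(i in S) p i))%:C *: weight_ket S p.
Proof.
move=> p_gt0; rewrite scaler_sumr; apply: eq_bigr => i iS.
rewrite scalerA -rmorphM /= mulrCA divff ?mulr1 //.
(* The normalization is nonzero because the term of [i] is positive; an empty [S] leaves nothing to
   prove. *)
rewrite sqrtr_eq0 -ltNge (bigD1 i) //= ltr_pwDl ?p_gt0 //.
by apply: sumr_ge0 => k /andP[/p_gt0/ltW].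
Qed.

(** Equal total weights let the normalizations cancel; then [U] sends |v> to |w>, and its adjoint
    undoes it on the span of the initial labels. *)
Lemma adj_unitary_weights :
  (U j)^t* *m \sum_(i in hs G j) amplitude j.+1 i *: ket R i
  = \sum_(i in gs G j) amplitude j i *: ket R i.
Proof.
have [_ _ _ ptsj ptsj1] := transition_sets gameG ltj.
have [ok /(_ j ltj)[_ _ _ sum_eq _] _ _] := gameG.
have [[UU' U'U] Uv _] := goodU.
rewrite (@weight_ketE _ (ph G j)); last first.
  move=> i ih; have [|//] := ok _ ltj i; by rewrite ptsj1 inE ih.
rewrite (@weight_ketE _ (pg G j)); last first.
  move=> i ig; have [|//] := ok _ (ltnW ltj) i; by rewrite ptsj inE ig.
rewrite -sum_eq -scalemxAr -Uv mulmxA UU'; congr (_ *: _).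
rewrite mulmx_sumr; apply: eq_bigr => i ig; rewrite -scalemxAr proj_obs obs_ket.
by rewrite inE ig scale1r.
Qed.

(** Seen by the rotating player, the moved part is a duplicated vector next to an idle register, the
    form on which [diag_op] acts as [U]. *)
Lemma moved_ketE (S : {set L}) n : pts (frm G n) = S :|: ks G j ->
  [disjoint S & ks G j] -> S \subset gs G j :|: hs G j ->
  moved_ket S n = ket_at R join2 None *m (dup R (gs G j :|: hs G j)
      *m \sum_(i in S) amplitude n i *: ket R i)
    + \sum_(i in ks G j) amplitude n i *: ket R (join2 (Some i, None, Some i)).
Proof.
move=> pE Sk sub; rewrite /moved_ket pE (bigID (mem S)) /=; congr (_ + _).
  rewrite !mulmx_sumr; apply: eq_big => [i|i /andP[_ iS]].
    by rewrite in_setU; case: (i \in S); rewrite ?andbF.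
  rewrite -!scalemxAr dup_ket (subsetP sub _ iS) scale1r ket_at_ket joinE.
  by rewrite iS.
apply: eq_big => [i|i /andP[_ /negPf ->]]; last by rewrite joinE.
rewrite in_setU; have [ik|ik] := boolP (i \in ks G j); last first.
  by rewrite orbF andbN.
by rewrite (disjointFl Sk ik).
Qed.

(** The duplicated part is rotated back to the initial weights; an unchanged label comes with an
    idle message, outside the duplicated span, and is fixed. *)
Lemma lift_rotation_moved :
  lift_op split2 ((diag_op (gs G j :|: hs G j) (U j))^t*) *m moved_ket (hs G j) j.+1
  = moved_ket (gs G j) j.
Proof.
have [gh gk hk ptsj ptsj1] := transition_sets gameG ltj.
have [_ /(_ j ltj)[_ keep _ _ _] _ _] := gameG.
have [unitU _ _] := goodU.
rewrite (moved_ketE ptsj1 hk) ?subsetUr // (moved_ketE ptsj gk) ?subsetUl //.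
rewrite mulmxDr; congr (_ + _).
  rewrite mulmxA (lift_op_ket_at split2K join2K) -mulmxA; congr (_ *m _).
  by rewrite mulmxA adj_diag_op_dup // -mulmxA adj_unitary_weights.
rewrite mulmx_sumr; apply: eq_bigr => i ik; rewrite -scalemxAr.
rewrite (lift_op_ket split2K join2K) adj_diag_op_ket // ket_at_ket.
by rewrite /amplitude; case: (keep i ik) => _ ->.
Qed.

(** Each state lies in the range of the projector measured next, so no failure occurs, and the
    canonical state of frame [j.+1] is taken back to that of frame [j]. *)
Lemma honest_transition :
  let psi3 := canonical_ket j.+1 in
  let psi2 := lift_op split1 (passed (adj_action (last_swap G j))) *m psi3 in
  let psi1 := lift_op split2 (passed (adj_action (rotation G U j))) *m psi2 in
  [/\ lift_op split1 (failed (adj_action (last_swap G j))) *m psi3 = 0,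
      lift_op split2 (failed (adj_action (rotation G U j))) *m psi2 = 0,
      lift_op split1 (failed (adj_action (first_swap G j))) *m psi1 = 0
    & lift_op split1 (passed (adj_action (first_swap G j))) *m psi1 = canonical_ket j].
Proof.
move=> psi3 psi2 psi1.
have psi2E : psi2 = moved_ket (hs G j) j.+1.
  rewrite /psi2 (lift_opM split1K join1K) -mulmxA lift_label_proj_canonical.
  by rewrite [act_U _]adj_swap_op lift_swap_canonical.
have psi1E : psi1 = moved_ket (gs G j) j.
  rewrite /psi1 psi2E (lift_opM split2K join2K) -mulmxA lift_label_proj_moved.
  exact: lift_rotation_moved.
split.
- rewrite lift_opB (lift_op_id R split1K) mulmxBl mul1mx.
  by rewrite lift_label_proj_canonical subrr.
- rewrite psi2E lift_opB (lift_op_id R split2K) mulmxBl mul1mx.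
  by rewrite lift_label_proj_moved subrr.
- by rewrite lift_opB subrr mul0mx.
- by rewrite psi1E /passed /= mulmx1 adj_swap_op lift_swap_moved.
Qed.

End HonestTransition.

(** * The complete protocol *)

Section Protocol.

Variables (R : realType) (L : finType) (G : point_game R L) (U : nat -> Op R L).
Variables (alpha beta : R).
Hypothesis gameG : is_tdpg G beta alpha.
Hypothesis goodU : forall j, (j < len G)%N -> good_unitary G j (U j).
Local Notation reg := (option L).

Definition reversed_rounds n : seq (round R reg reg reg) :=
  [seq adj_round r | r <- rev (flatten [seq tef_rounds_fwd G U j | j <- iota 0 n])].

(** Reversal puts the last transition first, which allows inductions that peel rounds off the
    front. *)
Lemma reversed_roundsS n :
  reversed_rounds n.+1
  = match dir G n with
    | Horizontal => [:: ByBob _ (adj_action (last_swap G n));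
                        ByAlice _ (adj_action (rotation G U n));
                        ByBob _ (adj_action (first_swap G n))]
    | Vertical => [:: ByAlice _ (adj_action (last_swap G n));
                      ByBob _ (adj_action (rotation G U n));
                      ByAlice _ (adj_action (first_swap G n))]
    end ++ reversed_rounds n.
Proof.
rewrite /reversed_rounds -{1}addn1 iotaD add0n map_cat flatten_cat rev_cat map_cat.
by congr (_ ++ _); rewrite /= cats0 /tef_rounds_fwd; case: (dir G n).
Qed.

(** Alice rotates in the horizontal transitions, so her dual operator carries x-coordinates; Bob's
    carries y-coordinates. *)
Lemma alice_view_tef : alice_view (tef G U) = honest_view G U Horizontal (len G).
Proof.
rewrite /alice_view /= -/(reversed_rounds _); elim: (len G) => // n IH.
by rewrite reversed_roundsS map_cat IH /=; case: (dir G n).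
Qed.

Lemma bob_view_tef : bob_view (tef G U) = honest_view G U Vertical (len G).
Proof.
rewrite /bob_view /= -/(reversed_rounds _); elim: (len G) => // n IH.
by rewrite reversed_roundsS map_cat IH /=; case: (dir G n).
Qed.

Lemma final_coord d : coord_obs G d (len G) (Some (lab_end G)) = along d (beta, alpha).
Proof.
by case: gameG => _ _ _ [pE posE _]; rewrite /= pE posE inE eqxx.
Qed.

(** On the frame [0,1], [1,0] the x-coordinates are 0 and 1, so there the dual operator is Alice's
    projector for outcome 1; at the other end it takes the value [beta]. *)
Lemma tef_PB_star_le : (PB_star (tef G U) <= beta%:E)%E.
Proof.
rewrite -[beta](final_coord Horizontal) /PB_star alice_view_tef /= proj_obs.
apply: (@cheat_value_le _ _ _ _ _ _ _ (coord_obs G Horizontal (len G))).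
apply: (honest_view_feasible gameG goodU _ (leqnn _)) => a.
have [_ _ [ne pE [p01 _] [p10 _]] _] := gameG.
case: a => [i|] /=; last by rewrite inE.
rewrite !inE (inj_eq Some_inj) pE !inE.
have [->|_] := eqVneq i (lab10 G); first by rewrite orbT p10 mulr1n.
by rewrite orbF; case: eqP => [->|]; rewrite ?p01 // mul0rn.
Qed.

Lemma tef_PA_star_le : (PA_star (tef G U) <= alpha%:E)%E.
Proof.
rewrite -[alpha](final_coord Vertical) /PA_star bob_view_tef /= proj_obs.
apply: (@cheat_value_le _ _ _ _ _ _ _ (coord_obs G Vertical (len G))).
apply: (honest_view_feasible gameG goodU _ (leqnn _)) => a.
have [_ _ [ne pE [p01 _] [p10 _]] _] := gameG.
case: a => [i|] /=; last by rewrite inE.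
rewrite !inE (inj_eq Some_inj) pE !inE.
have [->|_] := eqVneq i (lab01 G); first by rewrite p01 mulr1n.
by case: eqP => [->|]; rewrite ?p10 // mul0rn.
Qed.

Let canonical n := canonical_ket G (@joinBM reg reg reg) n.

Lemma honest_reversed n : (n <= len G)%N ->
  never_fails (reversed_rounds n) (canonical n)
  /\ honest_run (reversed_rounds n) (canonical n) = canonical 0.
Proof.
have n0 : normsq (0 : Ket R (reg * reg * reg)%type) = 0 by rewrite /normsq mulmx0 mxE.
elim: n => [//|n IH ltn]; have {IH}[IHf IHr] := IH (ltnW ltn).
have joinV a b m : @joinBM reg reg reg (a, m, b) = joinAM (b, m, a) by [].
have joinH a b m : @joinAM reg reg reg (a, m, b) = joinBM (b, m, a) by [].
rewrite reversed_roundsS; case: (dir G n) => /=.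
  have [f3 f2 f1 p] := honest_transition gameG ltn (goodU ltn)
    (@splitBMK reg reg reg) (@joinBMK reg reg reg)
    (@splitAMK reg reg reg) (@joinAMK reg reg reg) joinH.
  by rewrite /canonical p f3 f2 f1 n0.
have [f3 f2 f1 p] := honest_transition gameG ltn (goodU ltn)
    (@splitAMK reg reg reg) (@joinAMK reg reg reg)
    (@splitBMK reg reg reg) (@joinBMK reg reg reg) joinV.
(* Both private registers carry the same label in a canonical state, so the grouping used to write
   it makes no difference. *)
by rewrite /canonical p f3 f2 f1 n0.
Qed.

(** A frame with a single point of weight 1 has a product state as its canonical state. *)
Lemma initial_canonical : initial_state (tef G U) = canonical (len G).
Proof.
have [_ _ _ [pE _ wE]] := gameG; rewrite /canonical /canonical_ket pE big_set1.
rewrite /amplitude wE sqrtr1 scale1r; apply: ketP => -[[a b] m].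
rewrite /initial_state {1}/kentry mxE enum_rankK /= !kentry_ket -!natrM !mulnb.
by rewrite /joinBM /= !xpair_eqE.
Qed.

Lemma reversed_rounds_ok n : (n <= len G)%N ->
  forall k r, onth (reversed_rounds n) k = Some r -> round_ok r.
Proof.
elim: n => [|n IH ltn]; first by move=> _ [].
have [unitU _ _] := goodU ltn.
have projE := label_proj_projective R (hs G n :|: ks G n).
have ok1 : action_ok (adj_action (first_swap G n)).
  split; first by rewrite trmxC_unitary; apply: swap_op_unitary.
  by split; rewrite ?adjmx1 ?mulmx1.
have ok2 : action_ok (adj_action (rotation G U n)).
  by split=> //; rewrite trmxC_unitary; apply: diag_op_unitary.
have ok3 : action_ok (adj_action (last_swap G n)).
  by split=> //; rewrite trmxC_unitary; apply: swap_op_unitary.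
move=> k r; rewrite reversed_roundsS; have IHk k' := IH (ltnW ltn) k' r.
by case: (dir G n) => /=; case: k => [[<-]|[[<-]|[[<-]|k]]];
  [exact: ok3|exact: ok2|exact: ok1|exact: IHk
  |exact: ok3|exact: ok2|exact: ok1|exact: IHk].
Qed.

Lemma normsq_ketD (T : finType) (s t : T) (a b : R) : s != t ->
  normsq (a%:C *: ket R s + b%:C *: ket R t) = a ^+ 2 + b ^+ 2.
Proof.
move=> ne; rewrite /normsq -[X in X *m _]mulmx1 quad_lin2 !entry_quad !entry1.
rewrite !eqxx eq_sym (negPf ne) !mulr0 !mulr1 addr0 add0r.
have conjR (x : R) : Num.conj x%:C = x%:C :> R[i] by exact: conjc_real.
by rewrite !conjR -!rmorphM -rmorphD /= -!expr2.
Qed.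

Lemma normsq_ket (T : finType) (t : T) : normsq (ket R t) = 1.
Proof. by rewrite /normsq adj_ket_ket eqxx mxE. Qed.

Lemma proj_projective (T : finType) (S : {set T}) : projective (proj R S).
Proof.
rewrite proj_obs; split; first exact: adj_obs.
by rewrite obsM; apply: eq_obs => t; rewrite -natrM mulnb andbb.
Qed.

Lemma projectiveC (T : finType) (X : Op R T) : projective X -> projective (1%:M - X).
Proof.
case=> adjX XX; split; first by rewrite adjmxB adjmx1 adjX.
by rewrite mulmxBl mul1mx mulmxBr mulmx1 XX subrr subr0.
Qed.

(** The run ends in the equal superposition of the two doubled labels, on which the players'
    outcomes agree and each pair of equal outcomes selects one term. *)
Lemma honest_prob_tef a b :
  honest_prob (tef G U) a b = (a == b)%:R / 2.
Proof.
pose fA (c : bool) (r : reg) : R :=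
  if c then (r == Some (lab10 G))%:R else (r != Some (lab10 G))%:R.
pose fB (c : bool) (r : reg) : R :=
  if c then (r != Some (lab01 G))%:R else (r == Some (lab01 G))%:R.
have PiAE c : PiA (tef G U) c = obs (fA c).
  rewrite /= /fA proj_obs; case: c; first by apply: eq_obs => r; rewrite inE.
  rewrite -obs_cst1 obsB; apply: eq_obs => r; rewrite inE.
  by case: (r == _); rewrite ?subrr ?subr0.
have PiBE c : PiB (tef G U) c = obs (fB c).
  rewrite /= /fB proj_obs; case: c; last by apply: eq_obs => r; rewrite inE.
  rewrite -obs_cst1 obsB; apply: eq_obs => r; rewrite inE.
  by case: (r == _); rewrite ?subrr ?subr0.
have [_ _ [ne pE [_ w01] [_ w10]] _] := gameG.
rewrite /honest_prob PiAE PiBE initial_canonical.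
have [_ ->] := honest_reversed (leqnn _).
rewrite (lift_op_obs (@splitAK _ _ _)) (lift_op_obs (@splitBK _ _ _)) /=.
rewrite /canonical /canonical_ket pE big_setU1 ?inE //= big_set1.
rewrite !mulmxDr -!scalemxAr !obs_ket /= -!scalemxAr !obs_ket !scalerA -!rmorphM /=.
rewrite normsq_ketD; last first.
  by rewrite /joinBM /= !xpair_eqE !(inj_eq Some_inj) (negPf ne).
rewrite !exprMn /amplitude w01 w10 sqr_sqrtr ?invr_ge0 //.
rewrite /fA /fB !(inj_eq Some_inj) (negPf ne) eq_sym (negPf ne) !eqxx.
by case: a; case: b; rewrite /= !expr1n !expr0n /= ?mulr0 ?mulr1;
  rewrite ?addr0 ?add0r ?mul0r ?mul1r.
Qed.

Lemma tef_is_wcf : is_wcf (tef G U).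
Proof.
split.
- split=> [|||//|//].
  + by split; apply: normsq_ket.
  + exact: reversed_rounds_ok (leqnn _).
  + by case; split; rewrite /=; try apply: projectiveC; apply: proj_projective.
  + by rewrite /= subrK.
  + by rewrite /= addrC subrK.
- by rewrite initial_canonical; case: (honest_reversed (leqnn _)).
- by rewrite !honest_prob_tef mul0r.
- by rewrite !honest_prob_tef mul1r.
Qed.

End Protocol.

Theorem theorem1 (R : realType) (L : finType) (G : point_game R L)
    (alpha beta : R) (U : nat -> Op R L)
    (hG : is_tdpg G beta alpha)
    (hU : forall j : nat, (j < len G)%N -> good_unitary G j (U j)) :
  [/\ is_wcf (tef G U),
      (PA_star (tef G U) <= alpha%:E)%E
    & (PB_star (tef G U) <= beta%:E)%E].
Proof.
split.
- exact: tef_is_wcf hG hU.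
- exact: tef_PA_star_le hG hU.
- exact: tef_PB_star_le hG hU.
Qed.
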